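(* Let $n\ge 1$ and $0<p\le\infty$. There exist constants $C,C'>0$, depending only on $n$ and $p$, such that for all $\alpha,\beta>0$ and every locally square integrable function $g$ on $\mathbb{R}^{n+1}_+$, $$ C\,\underline{h}(p,\alpha/\beta)\,\|g\|_{T^{p,2}_{\alpha}}\ \le\ \|g\|_{T^{p,2}_{\beta}}\ \le\ C'\,\overline{h}(p,\alpha/\beta)\,\|g\|_{T^{p,2}_{\alpha}} . $$ Moreover, the dependence on $\alpha/\beta$ is best possible in the sense that this growth is attained: there exist constants $c,c'>0$ depending only on $n$ and $p$ such that for all $\alpha,\beta>0$ there are locally square integrable functions $g_1,g_2$ on $\mathbb{R}^{n+1}_+$ with $0<\|g_i\|_{T^{p,2}_\alpha}<\infty$ ($i=1,2$) and $$ \|g_1\|_{T^{p,2}_{\beta}}\ \le\ c\,\underline{h}(p,\alpha/\beta)\,\|g_1\|_{T^{p,2}_{\alpha}},\qquad \|g_2\|_{T^{p,2}_{\beta}}\ \ge\ c'\,\overline{h}(p,\alpha/\beta)\,\|g_2\|_{T^{p,2}_{\alpha}} . $$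
   Context: Notation: $\mathbb{R}^{n+1}_+=\{(t,y): t>0,\ y\in\mathbb{R}^n\}$, and $B(x,r)$ is the open ball in $\mathbb{R}^n$ with center $x$ and radius $r>0$; $|B|$ is its Lebesgue measure. For $\alpha>0$, a locally square integrable function $g$ on $\mathbb{R}^{n+1}_+$, and $x\in\mathbb{R}^n$, set $$A^{(\alpha)}g(x)=\Big(\int_{\mathbb{R}^{n+1}_+}\frac{1_{B(x,\alpha t)}(y)}{t^n}\,|g(t,y)|^2\,\frac{dy\,dt}{t}\Big)^{1/2}\in[0,\infty].$$ For $0<p<\infty$, $\|g\|_{T^{p,2}_\alpha}=\|A^{(\alpha)}g\|_{p}$, where $\|\cdot\|_p$ is the $L^p(\mathbb{R}^n)$ (quasi-)norm (possibly $+\infty$). For $p=\infty$: for an open ball $B=B(x,r)$, the tent of aperture $\alpha$ above $B$ is $T_\alpha B=\{(t,y): 0<t<r/\alpha,\ y\in B(x,r-\alpha t)\}$, and $\|g\|_{T^{\infty,2}_\alpha}$ is the infimum of all $C\ge 0$ such that for every open ball $B\subset\mathbb{R}^n$, $$\int_{T_\alpha B}|g(t,y)|^2\,\frac{dy\,dt}{t}\le C^2\,\frac{|B|}{\alpha^n}$$ (with value $+\infty$ if no such $C$ exists). For $\gamma>0$: $\underline{h}(p,\gamma)=\min(\gamma^{-n/2},\gamma^{-n/p})$ and $\overline{h}(p,\gamma)=\max(\gamma^{-n/2},\gamma^{-n/p})$, with the convention $n/p=0$ when $p=\infty$. *)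

(* Defs.v *)
From HB Require Import structures.
From mathcomp Require Import all_boot all_order all_algebra.
From mathcomp Require Import complex.
From mathcomp Require Import all_classical all_reals all_analysis.

Set Implicit Arguments.
Unset Strict Implicit.
Unset Printing Implicit Defensive.

Import Order.TTheory GRing.Theory Num.Theory.
Import numFieldTopology.Exports numFieldNormedType.Exports.

Local Open Scope classical_set_scope.
Local Open Scope ring_scope.

(* R^n; n.-tuple carries the sigma-algebra generated by the coordinates. *)
Notation euclid R n := (n.-tuple (measurableTypeR R)).

(* The pairs (t, y) of R^(n+1), n being the dimension of the space variable. *)
Notation spacetime R n := (measurableTypeR R * euclid R n)%type.

Definition tcons (T : Type) (n : nat) (z : T * n.-tuple T) : n.+1.-tuple T :=
  [tuple of z.1 :: z.2].

Lemma product_measure_sigma_finite d1 d2 (T1 : measurableType d1)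
    (T2 : measurableType d2) (R : realType)
    (m1 : {sigma_finite_measure set T1 -> \bar R})
    (m2 : {sigma_finite_measure set T2 -> \bar R}) :
  sigma_finite setT (m1 \x m2)%E.
Proof.
have /sigma_finiteP[F [TF ndF Foo]] := sigma_finiteT m1.
have /sigma_finiteP[G [TG ndG Goo]] := sigma_finiteT m2.
exists (fun k => F k `*` G k).
  rewrite -setXTT TF TG predeqE => -[x y]; split.
    move=> [/= [k _ Fkx] [j _ Gjy]]; exists (maxn k j) => //; split.
    - by move: x Fkx; exact/subsetPset/ndF/leq_maxl.
    - by move: y Gjy; exact/subsetPset/ndG/leq_maxr.
  by move=> [k _ []/= ? ?]; split; exists k.
move=> k; have [mF Fk] := Foo k; have [mG Gk] := Goo k.
split; first exact: measurableX.
by rewrite product_measure1E// lte_mul_pinfty// ge0_fin_numE.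
Qed.

(* The library has no Lebesgue measure on R^n for n > 1; lebesgue_tuple below
   is the n-fold product of lebesgue_measure. *)
Section lebesgue_tuple_succ.
Local Open Scope ereal_scope.
Context {R : realType} {n : nat}.
Variable mu : {sigma_finite_measure set (euclid R n) -> \bar R}.

Let measurable_tcons :
  measurable_fun [set: spacetime R n] (@tcons (measurableTypeR R) n).
Proof. exact: measurable_cons. Qed.

HB.instance Definition _ :=
  isMeasurableFun.Build _ _ _ _ (@tcons (measurableTypeR R) n) measurable_tcons.

Definition lebesgue_tuple_succ : set (euclid R n.+1) -> \bar R :=
  pushforward (lebesgue_measure \x mu) (@tcons (measurableTypeR R) n).

Let lebesgue_tuple_succ0 : lebesgue_tuple_succ set0 = 0.
Proof. by rewrite /lebesgue_tuple_succ /pushforward preimage_set0 measure0. Qed.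

Let lebesgue_tuple_succ_ge0 A : 0 <= lebesgue_tuple_succ A.
Proof. exact: measure_ge0. Qed.

Let lebesgue_tuple_succ_sigma_additive :
  semi_sigma_additive lebesgue_tuple_succ.
Proof. exact: measure_semi_sigma_additive. Qed.

HB.instance Definition _ := isMeasure.Build _ _ _ lebesgue_tuple_succ
  lebesgue_tuple_succ0 lebesgue_tuple_succ_ge0
  lebesgue_tuple_succ_sigma_additive.

Let lebesgue_tuple_succ_sigma_finite :
  sigma_finite [set: euclid R n.+1] lebesgue_tuple_succ.
Proof.
pose u (v : euclid R n.+1) : spacetime R n :=
  (tnth v ord0, [tuple of behead v]).
have mu' : measurable_fun setT u.
  apply: measurable_fun_pair; [exact: measurable_tnth|exact: measurable_behead].
have [F TF Fm] :=
  product_measure_sigma_finite (@lebesgue_measure R) mu.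
exists (fun k => u @^-1` F k).
  by rewrite -preimage_bigcup -TF preimage_setT.
move=> k; have [mF Foo] := Fm k; split.
  by rewrite -[X in measurable X]setTI; exact: mu'.
rewrite /lebesgue_tuple_succ /pushforward -comp_preimage.
rewrite (_ : u \o _ = id) ?preimage_id//; apply/funext => -[a v].
by rewrite /u /=; congr pair; exact/val_inj.
Qed.

HB.instance Definition _ := @Measure_isSigmaFinite.Build _ _ _
  lebesgue_tuple_succ lebesgue_tuple_succ_sigma_finite.

End lebesgue_tuple_succ.

Fixpoint lebesgue_tuple (R : realType) (n : nat) :
    {sigma_finite_measure set (euclid R n) -> \bar R} :=
  match n with
  | 0 => \d_([tuple] : euclid R 0)
  | m.+1 => lebesgue_tuple_succ (lebesgue_tuple R m)
  end.

Lemma lebesgue_tuple_box (R : realType) (n : nat)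
    (A : 'I_n -> set (measurableTypeR R)) (mA : forall i, measurable (A i)) :
  lebesgue_tuple R n [set v : euclid R n | forall i, A i (tnth v i)] =
  (\prod_(i < n) lebesgue_measure (A i))%E.
Proof.
elim: n A mA => [|n IHn] A mA /=.
  by rewrite big_ord0 diracE mem_set// => -[].
rewrite big_ord_recl -IHn; last by move=> i; exact: mA.
rewrite -product_measure1E//; last first.
  rewrite (_ : [set v | _] =
      \bigcap_(i in [set: 'I_n]) ((@tnth _ _ ^~ i) @^-1` A (lift ord0 i))).
    apply: fin_bigcap_measurable => // i _.
    by rewrite -[X in measurable X]setTI; exact: measurable_tnth.
  by apply/seteqP; split => v /= Av i; [move=> _|]; exact: Av.
rewrite /lebesgue_tuple_succ /pushforward; congr (product_measure1 _ _ _).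
apply/seteqP; split => -[a v] /= => [Av|[Aa Av] i].
  split; first exact: (Av ord0).
  by move=> i; have := Av (lift ord0 i); rewrite tnthS.
case: (unliftP ord0 i) => [j|] ->; last exact: Aa.
by rewrite tnthS; exact: Av.
Qed.

Definition lebesgue_spacetime (R : realType) (n : nat) :
    set (spacetime R n) -> \bar R :=
  (lebesgue_measure \x lebesgue_tuple R n)%E.
Arguments lebesgue_spacetime : clear implicits.

HB.instance Definition _ (R : realType) (n : nat) :=
  Measure.on (lebesgue_spacetime R n).
HB.instance Definition _ (R : realType) (n : nat) :=
  @Measure_isSigmaFinite.Build _ _ _ (lebesgue_spacetime R n)
    (product_measure_sigma_finite lebesgue_measure (lebesgue_tuple R n)).

Section tent_space.
Context {R : realType} {n : nat}.
Implicit Types (x : euclid R n) (r alpha : R) (z : spacetime R n)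
  (p : \bar R) (g : spacetime R n -> R[i]).

(* Euclidean ball; the library's norm on row vectors is the sup norm. *)
Definition eball x r : set (euclid R n) :=
  [set y | Num.sqrt (\sum_(i < n) ((tnth y i : R) - tnth x i) ^+ 2) < r].

(* Functions on the upper half-space are encoded as functions on R x R^n whose
   values for t <= 0 are never used. *)
Definition upper_half : set (spacetime R n) := [set z | 0 < (z.1 : R)].

Definition sqnorm (w : R[i]) : R := complex.Re w ^+ 2 + complex.Im w ^+ 2.

(* n.-tuple has no topology in the library: compactness is read in
   R * 'rV[R]_n through this bijection. *)
Definition to_row z : R * 'rV[R]_n := (z.1, \row_i tnth z.2 i).

(* Lebesgue measurability: almost everywhere equal to a Borel function. *)
Definition ae_measurable g := exists h : spacetime R n -> R[i],
  [/\ measurable_fun upper_half (fun z => complex.Re (h z)),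
      measurable_fun upper_half (fun z => complex.Im (h z)) &
      {ae lebesgue_spacetime R n, forall z, upper_half z -> g z = h z}].

Definition locally_square_integrable g :=
  ae_measurable g /\
  forall K, compact (to_row @` K) -> K `<=` upper_half ->
    (\int[lebesgue_spacetime R n]_(z in K) (sqnorm (g z))%:E < +oo)%E.

Definition area alpha g x : \bar R :=
  ((\int[lebesgue_spacetime R n]_(z in upper_half)
     (\1_(eball x (alpha * z.1)) z.2 / z.1 ^+ n * sqnorm (g z) / z.1)%:E)
   `^ 2^-1)%E.

Definition tent alpha x r : set (spacetime R n) :=
  [set z | 0 < (z.1 : R) < r / alpha /\ eball x (r - alpha * z.1) z.2].

Definition carleson_bound alpha g : set R :=
  [set C | 0 <= C /\ forall x r, 0 < r ->
    (\int[lebesgue_spacetime R n]_(z in tent alpha x r)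
        (sqnorm (g z) / z.1)%:E <=
      (C ^+ 2)%:E * (lebesgue_tuple R n (eball x r) / (alpha ^+ n)%:E))%E].

(* Only 0 < p is meaningful; ereal_inf set0 = +oo. *)
Definition tent_norm p alpha g : \bar R :=
  match p with
  | q%:E => Lnorm (lebesgue_tuple R n) q%:E (area alpha g)
  | +oo%E => ereal_inf (EFin @` carleson_bound alpha g)
  | -oo%E => 0%E
  end.

End tent_space.

(* n / p, equal to 0 when p is infinite. *)
Definition dim_over (R : realType) (n : nat) (p : \bar R) : R :=
  if p is q%:E then n%:R / q else 0.

Definition h_low (R : realType) (n : nat) (p : \bar R) (gamma : R) : R :=
  Num.min (gamma `^ (- (n%:R / 2))) (gamma `^ (- dim_over n p)).

Definition h_up (R : realType) (n : nat) (p : \bar R) (gamma : R) : R :=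
  Num.max (gamma `^ (- (n%:R / 2))) (gamma `^ (- dim_over n p)).

(* Main.v *)
From HB Require Import structures.
Require Import Defs.
From mathcomp Require Import all_boot all_order all_algebra.
From mathcomp Require Import complex.
From mathcomp Require Import all_classical all_reals all_analysis.
From mathcomp Require Import measurable_realfun ring lra.

(** For [q = p / 2] and the measure [nu] with density [|g(t,y)|^2 / t^(n+1)],
    the square of the area function at [x] is the mass [S_a(x) = nu(cone a x)]
    of the cone of aperture [a] above [x]. So for finite [p] the upper bound
    says that [X_a], the integral of [S_a ^ q], satisfies
      [X_b <= C max((b/a)^n, (b/a)^(nq)) X_a],
    and the lower bound is the upper one with the apertures exchanged, because
    [h_up n p (b/a) * h_low n p (a/b) = 1].

    Let [G_a(x,t)] be the mass of the part of [cone a x] at height at least [t].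
    Three facts carry the argument.
    - [S ^ q] is controlled by the integral over the cone of [G ^ (q-1)] when
      [q >= 1] ([measure_power_le_tail]), and controls it when [q <= 1]
      ([tail_neg_power_le]).
    - Above height [t], enlarging the aperture by [c] absorbs a horizontal move
      of length less than [c t]: [G_b(x,t) <= G_(c+b)(x',t)]
      ([cone_tail_shift]).
    - By Tonelli, replacing integrals over cones of aperture [b] by integrals
      over cones of aperture [a] costs the ratio [(b/a)^n] of volumes of balls,
      up to a constant ([cone_integral_compare]).
    Together they give, for [q >= 1] and [q <= 1] respectively,
      [X_b <= C (b/a)^n int S_a S_(a+2b)^(q-1)]  and
      [int S_b S_(b+2a)^(q-1) <= C (b/a)^n X_a].
    For [q >= 1] and [b <= a/4], the first one applied to [a - 2b] instead of
    [a] is the result, and for [a/4 < b <= a] it is enough that [X_b] increases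
    with [b]. In the other cases the product is split by a weighted inequality,
    which leaves [X_b] bounded by the expected multiple of [X_a] plus a small
    multiple of [X] at a larger aperture. When [b >= a] that aperture is at most
    [3b], and the extra term is absorbed: for the exponent [e] expected,
    [f(b) = X_b / b^e] satisfies [f(b) <= f(3b)/2 + A], so [f <= 2A] as soon as
    [f] is bounded ([absorb_half]). It is bounded when [nu] is finite and has
    bounded support; the general case follows by truncation and monotone
    convergence ([weighted_power_change]). When [b <= a] and [q <= 1], the
    larger aperture is at most [3a], and the case just treated compares it with
    [a].

    For infinite [p] the bounds are inclusions between tents of different
    apertures ([carleson_bound_change]).

    Both growth rates are attained by indicators of slabs
    [[1,2] x B(0,rho)]: their norm is comparable to
    [min(a,rho)^(n/2) max(a,rho)^(n/p)] ([slab_norm_bounds]). Comparing the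
    apertures [a] and [b], the choice [rho = max(a,b)] produces the exponent
    [n/2] and [rho = min(a,b)] the exponent [n/p]. *)

Set Implicit Arguments.
Unset Strict Implicit.
Unset Printing Implicit Defensive.

Import Order.TTheory GRing.Theory Num.Theory.
Import numFieldTopology.Exports numFieldNormedType.Exports.

Local Open Scope classical_set_scope.
Local Open Scope ring_scope.

(** * Euclidean balls and their volume *)

Section euclidean_balls.
Context {R : realType} {n : nat}.
Implicit Types (x y z : euclid R n) (r s : R).

Definition eudist x y : R :=
  Num.sqrt (\sum_(i < n) ((tnth y i : R) - tnth x i) ^+ 2).

Lemma eudist_ge0 x y : 0 <= eudist x y.
Proof. exact: sqrtr_ge0. Qed.

Lemma eudistC x y : eudist x y = eudist y x.
Proof.
rewrite /eudist; congr Num.sqrt; apply: eq_bigr => i _.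
by rewrite -sqrrN opprB.
Qed.

Lemma sum_sqr_ge0 (a : 'I_n -> R) : 0 <= \sum_i a i ^+ 2.
Proof. by apply: sumr_ge0 => i _; exact: sqr_ge0. Qed.

Lemma cauchy_schwarz_sum (a b : 'I_n -> R) :
  (\sum_i a i * b i) ^+ 2 <= (\sum_i a i ^+ 2) * (\sum_i b i ^+ 2).
Proof.
set A := \sum_i a i ^+ 2; set B := \sum_i b i ^+ 2; set P := \sum_i a i * b i.
(* the sum of the squares of s a_i - t b_i; below, s = B + 1 or P, and t = P or A *)
have h (s t : R) : 0 <= s ^+ 2 * A - 2 * s * t * P + t ^+ 2 * B.
  have := @sum_sqr_ge0 (fun i => s * a i - t * b i).
  congr (_ <= _); rewrite /A /B /P !mulr_sumr -sumrN -!big_split /=.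
  by apply: eq_bigr => i _; ring.
have A0 : 0 <= A by exact: sum_sqr_ge0.
have B0 : 0 <= B by exact: sum_sqr_ge0.
have [A00|A00] := eqVneq A 0.
  have := h (B + 1) P; rewrite A00 mulr0 add0r mul0r => h1.
  rewrite leNgt; apply/negP => P2; nra.
have Agt0 : 0 < A by rewrite lt_neqAle eq_sym A00.
have := h P A => h1.
have : 0 <= A * (A * B - P ^+ 2) by apply: le_trans h1 _; lra.
by rewrite pmulr_rge0// subr_ge0.
Qed.

Lemma eudist_triangle x y z : eudist x z <= eudist x y + eudist y z.
Proof.
rewrite /eudist.
set a := fun i => (tnth y i : R) - tnth x i.
set b := fun i => (tnth z i : R) - tnth y i.
rewrite (eq_bigr (fun i => (a i + b i) ^+ 2)); last first.
  by move=> i _; rewrite /a /b; congr (_ ^+ 2); ring.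
rewrite -[leRHS]ger0_norm ?addr_ge0 ?sqrtr_ge0// -sqrtr_sqr ler_sqrt ?sqr_ge0//.
rewrite sqrrD !sqr_sqrtr ?sum_sqr_ge0//.
have -> : \sum_i (a i + b i) ^+ 2 =
    \sum_i a i ^+ 2 + (\sum_i a i * b i) *+ 2 + \sum_i b i ^+ 2.
  by rewrite -sumrMnl -!big_split/=; apply: eq_bigr => i _; rewrite sqrrD.
rewrite lerD2r lerD2l lerMn2r/= -sqrtrM ?sum_sqr_ge0//.
apply: le_trans (ler_norm _) _; rewrite -sqrtr_sqr ler_sqrt ?cauchy_schwarz_sum//.
by rewrite mulr_ge0 ?sum_sqr_ge0.
Qed.

Definition origin : euclid R n := [tuple 0 | i < n].

Lemma eballE x r : eball x r = [set y | eudist x y < r].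
Proof. by []. Qed.

Lemma eball_sym x y r : eball x r y -> eball y r x.
Proof. by rewrite !eballE /= eudistC. Qed.

Lemma eball_gt0 x y r : eball x r y -> 0 < r.
Proof. by rewrite eballE /=; apply: le_lt_trans (eudist_ge0 _ _). Qed.

Lemma measurable_eudist d (T : measurableType d) (f g : T -> euclid R n) :
  measurable_fun setT f -> measurable_fun setT g ->
  measurable_fun setT (fun u => eudist (f u) (g u)).
Proof.
move=> mf mg.
apply: (@measurableT_comp _ _ _ _ _ _ (@Num.sqrt R) _ (fun u => \sum_(i < n)
    ((tnth (g u) i : R) - tnth (f u) i) ^+ 2)).
  by apply: continuous_measurable_fun; exact: sqrt_continuous.
apply: measurable_sum => i; apply: measurable_funX.
apply: measurable_funB.
- exact: (measurableT_comp (measurable_tnth i) mg).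
- exact: (measurableT_comp (measurable_tnth i) mf).
Qed.

Lemma measurable_eball x r : measurable (eball x r).
Proof.
have md := @measurable_eudist _ _ (cst x) id (measurable_cst _) (@measurable_id _ _ _).
have := md measurableT _ (measurable_itv `]-oo, r[).
by rewrite setTI.
Qed.

(** Balls are compared with cubes, whose volume is a product of lengths of
    intervals; this determines the volume of a ball up to a factor that depends
    only on the dimension, which is all that the estimates below require. *)
Definition cube x s : set (euclid R n) :=
  [set v | forall i, `](tnth x i : R) - s, tnth x i + s[%classic (tnth v i)].

Lemma measurable_cube x s : measurable (cube x s).
Proof.
rewrite /cube (_ : [set v | _] =
    \bigcap_(i in [set: 'I_n]) ((@tnth _ _ ^~ i) @^-1`
      (`](tnth x i : R) - s, tnth x i + s[%classic))).
  apply: fin_bigcap_measurable => // i _.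
  rewrite -[X in measurable X]setTI.
  apply: (@measurable_tnth _ (measurableTypeR R) n i measurableT).
  exact: (measurable_itv `](tnth x i : R) - s, tnth x i + s[).
by apply/seteqP; split => v /= Av i; [move=> _|]; exact: Av.
Qed.

Lemma cube_volume x s : 0 <= s ->
  lebesgue_tuple R n (cube x s) = ((2 * s) ^+ n)%:E.
Proof.
move=> s0; rewrite /cube (@lebesgue_tuple_box R n
    (fun i => `](tnth x i : R) - s, tnth x i + s[%classic)); last first.
  by move=> i; exact: (measurable_itv `](tnth x i : R) - s, tnth x i + s[).
rewrite (eq_bigr (fun=> (2 * s)%:E)).
  by rewrite prodEFin prodr_const card_ord.
move=> i _; rewrite lebesgue_measure_itv /= lte_fin.
case: ifPn => [_|]; first by rewrite -EFinB; congr EFin; ring.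
by rewrite -leNgt => ?; congr EFin; lra.
Qed.

Lemma eball_volume_le x r : 0 <= r ->
  (lebesgue_tuple R n (eball x r) <= ((2 * r) ^+ n)%:E)%E.
Proof.
move=> r0; rewrite -(cube_volume x)//.
apply: le_measure; rewrite ?inE; [exact: measurable_eball|exact: measurable_cube|].
move=> y; rewrite eballE /= => yr i; rewrite /= in_itv /=.
rewrite -ltr_distl; apply: le_lt_trans yr.
rewrite -sqrtr_sqr ler_sqrt ?sum_sqr_ge0//.
rewrite (bigD1 i)//= lerDl; apply: sumr_ge0 => j _; exact: sqr_ge0.
Qed.

(** The factor [n] in the radius comes from inscribing a cube of side [r / n] in
    the ball: its half-diagonal is at most [r / 2]. *)
Lemma eball_volume_ge x r : 0 < r ->
  (((r / n%:R) ^+ n)%:E <= lebesgue_tuple R n (eball x r))%E.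
Proof.
move=> r0.
have -> : r / n%:R = 2 * (r / (2 * n%:R)) :> R.
  by rewrite invfM [RHS]mulrCA (mulrA 2) divff// mul1r.
rewrite -(cube_volume x); last by rewrite divr_ge0 ?mulr_ge0// ltW.
apply: le_measure; rewrite ?inE; [exact: measurable_cube|exact: measurable_eball|].
move=> y yr; rewrite eballE /= /eudist.
rewrite -[ltRHS](ger0_norm (ltW r0)) -sqrtr_sqr ltr_sqrt ?exprn_gt0//.
have h (i : 'I_n) : ((tnth y i : R) - tnth x i) ^+ 2 <= (r / (2 * n%:R)) ^+ 2.
  have := yr i; rewrite /= in_itv /= -ltr_distl => /ltW.
  by rewrite -ler_sqr ?nnegrE// ?real_normK ?num_real// divr_ge0 ?mulr_ge0// ltW.
apply: le_lt_trans (ler_sum _ (fun i _ => h i)) _.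
rewrite sumr_const card_ord -[X in X < _]mulr_natr expr_div_n.
have [->|n0] := eqVneq n 0%N; first by rewrite mulr0 exprn_gt0.
have n1 : 1 <= n%:R :> R by rewrite ler1n lt0n.
have N0 : 0 < n%:R :> R by rewrite ltr0n lt0n.
have -> : r ^+ 2 / (2 * n%:R) ^+ 2 * n%:R = r ^+ 2 / (4 * n%:R).
  by field; rewrite pnatr_eq0.
rewrite ltr_pdivrMr ?mulr_gt0// ltr_pMr ?exprn_gt0//; lra.
Qed.

End euclidean_balls.

(** * Integrals of non-measurable functions, measures with a density *)

Section lower_integral.
Local Open Scope ereal_scope.
Context d (T : measurableType d) (R : realType).
Variable mu : {measure set T -> \bar R}.
Implicit Types (f g : T -> \bar R) (D E : set T).

(** The integral of a nonnegative function is the supremum of the integrals of the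
    simple functions below it, so it is monotone on arbitrary functions and sets.
    This serves for integrals over compact sets and over tents. *)
Lemma ge0_le_integral_sub D E f g :
  (forall x, D x -> 0 <= f x) -> (forall x, E x -> 0 <= g x) ->
  (forall x, D x -> E x /\ f x <= g x) ->
  \int[mu]_(x in D) f x <= \int[mu]_(x in E) g x.
Proof.
move=> f0 g0 fg; rewrite !ge0_integralE//.
apply: ge_ereal_sup => _ [h /= hf <-]; apply: ereal_sup_ubound; exists h => //= x.
apply: le_trans (hf x) _; rewrite !patchE; case: ifPn.
  by rewrite inE => /fg[Ex fgx]; rewrite mem_set.
by move=> _; case: ifPn => //; rewrite inE => /g0.
Qed.

Import HBNNSimple.

Let ae_le_integral_lower D f g :
  (forall x, D x -> 0 <= f x) -> (forall x, D x -> 0 <= g x) ->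
  {ae mu, forall x, D x -> f x = g x} ->
  \int[mu]_(x in D) f x <= \int[mu]_(x in D) g x.
Proof.
move=> f0 g0 [N [mN N0 fgN]].
rewrite [leLHS]ge0_integralE//.
apply: ge_ereal_sup => _ [h /= hf <-].
have -> : sintegral mu h = \int[mu]_x (h x)%:E.
  by rewrite integral_nnsfun// patch_setT.
rewrite (ge0_negligible_integral mN)//; last 2 first.
- exact/measurable_EFinP.
- by move=> x _; rewrite lee_fin fun_ge0.
rewrite [leRHS]integral_mkcond; apply: ge0_le_integral_sub.
- by move=> x _; rewrite lee_fin fun_ge0.
- by move=> x _; exact: erestrict_ge0.
move=> x [_ Nx]; split=> //; apply: le_trans (hf x) _.
rewrite !patchE; case: ifPn => //; rewrite inE => Dx.
have : ~ ~ (D x -> f x = g x) by move=> /fgN.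
by move=> /contrapT ->.
Qed.

(** Restricting a simple function to the complement of a negligible set does not
    change its integral; hence a Lebesgue measurable function may be replaced by
    its Borel representative in every integral that defines the norms. *)
Lemma ae_eq_integral_lower D f g :
  (forall x, D x -> 0 <= f x) -> (forall x, D x -> 0 <= g x) ->
  {ae mu, forall x, D x -> f x = g x} ->
  \int[mu]_(x in D) f x = \int[mu]_(x in D) g x.
Proof.
move=> f0 g0 fg; apply/eqP; rewrite eq_le !ae_le_integral_lower//.
by move: fg; apply: filterS => x + Dx => /(_ Dx) ->.
Qed.

End lower_integral.

(** The three properties of [f] are arguments so that the measure structures
    declared below can be inferred from the term itself. *)
Definition density_measure d (T : measurableType d) (R : realType)
    (mu : {measure set T -> \bar R}) (f : T -> \bar R)
    of measurable_fun setT f & (forall x, 0 <= f x)%E &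
    (\int[mu]_x f x < +oo)%E : set T -> \bar R :=
  fun A => (\int[mu]_(x in A) f x)%E.

Section density_measure.
Local Open Scope ereal_scope.
Context d (T : measurableType d) (R : realType).
Variables (mu : {measure set T -> \bar R}) (f : T -> \bar R).
Hypotheses (mf : measurable_fun setT f) (f0 : forall x, 0 <= f x)
  (foo : \int[mu]_x f x < +oo).
Local Notation nu := (density_measure mf f0 foo).

Let density0 : nu set0 = 0. Proof. exact: integral_set0. Qed.

Let density_ge0 A : 0 <= nu A. Proof. exact: integral_ge0. Qed.

Let density_sigma_additive : semi_sigma_additive nu.
Proof.
move=> /= A mA tA mUA; rewrite /density_measure ge0_integral_bigcup//.
  by apply: is_cvg_ereal_nneg_natsum_cond => n _ _; exact: integral_ge0.
exact: measurable_funTS.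
Qed.

HB.instance Definition _ := isMeasure.Build _ _ _ nu
  density0 density_ge0 density_sigma_additive.

Let density_fin : fin_num_fun nu.
Proof.
move=> A mA; rewrite ge0_fin_numE//; apply: le_lt_trans foo.
by apply: ge0_le_integral_sub.
Qed.

HB.instance Definition _ := @Measure_isFinite.Build _ T _ nu density_fin.

Definition density_finite_measure : {finite_measure set T -> \bar R} := nu.

End density_measure.

(** * Upper tails of a finite measure *)

Section upper_tail.
Local Open Scope ereal_scope.
Context d (T : measurableType d) (R : realType).
Variables (nu : {finite_measure set T -> \bar R}) (A : set T) (tau : T -> R).
Hypotheses (mA : measurable A) (mtau : measurable_fun setT tau)
  (tau0 : forall z, A z -> (0 < tau z)%R).

Definition upper_tail (t : R) : \bar R := nu (A `&` [set z | (t <= tau z)%R]).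
Local Notation G := upper_tail.

Lemma measurable_tail_set t : measurable (A `&` [set z | (t <= tau z)%R]).
Proof.
apply: measurableI => //.
have := mtau measurableT (measurable_itv `[t, +oo[).
by rewrite setTI; congr measurable; apply/seteqP; split => z /=;
  rewrite in_itv/= andbT.
Qed.

Lemma upper_tail_antitone s t : (s <= t)%R -> G t <= G s.
Proof.
move=> st; apply: le_measure; rewrite ?inE; try exact: measurable_tail_set.
by move=> z [Az tz]; split => //=; exact: le_trans tz.
Qed.

Lemma upper_tail_le t : G t <= nu A.
Proof.
by apply: le_measure; rewrite ?inE//; exact: measurable_tail_set.
Qed.

Lemma measurable_upper_tail : measurable_fun setT G.
Proof.
pose P : set (R * T) := [set u | A u.2 /\ (u.1 <= tau u.2)%R].
suff mP : measurable P.
  have := measurable_fun_xsection nu mP.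
  congr measurable_fun; apply/funext => t; rewrite /= /upper_tail; congr (nu _).
  by apply/seteqP; split => z; rewrite xsectionE.
rewrite (_ : P = (snd @^-1` A) `&` [set u | (u.1 <= tau u.2)%R]); last first.
  by apply/seteqP; split.
apply: measurableI.
  by rewrite -[X in measurable X]setTI; exact: measurable_snd.
have := @measurable_fun_ler _ _ R setT (fun u : R * T => u.1)
  (fun u => tau u.2) (measurable_fst) (measurableT_comp mtau measurable_snd).
move=> /(_ measurableT [set true]); rewrite setTI.
by apply.
Qed.

(** The set of levels [t] with [G t <= s] is an up-closed interval. If it contains
    its infimum [t0], the mass in question is [G t0]; otherwise it is the limit of
    [G (t0 + 1/(k+1))]. The infimum exists because [tau] is positive on [A]. *)
Lemma upper_tail_small s : 0 <= s -> nu (A `&` [set z | G (tau z) <= s]) <= s.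
Proof.
move=> s0.
pose U : set R := [set t | (0 < t)%R /\ G t <= s].
have Uup t u : U t -> (t <= u)%R -> U u.
  move=> [t0 ts] tu; split; first exact: lt_le_trans tu.
  exact: le_trans (upper_tail_antitone tu) ts.
have AU : A `&` [set z | G (tau z) <= s] = A `&` [set z | U (tau z)].
  apply/seteqP; split => z /= [Az] => [Gz|[]//].
  by split => //; split => //; exact: tau0.
rewrite AU.
have [->|/set0P U0] := eqVneq U set0.
  by rewrite (_ : A `&` _ = set0) ?measure0//; apply/seteqP; split => z // [].
have Ulb : has_lbound U by exists 0%R => t [/ltW].
have hU : has_inf U by [].
pose t k : R := (inf U + k.+1%:R^-1)%R.
have Ut k : U (t k).
  have [|u Uu uk] := inf_lt U0 (x := t k); last exact: Uup Uu (ltW uk).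
  by rewrite ltrDl invr_gt0.
have [aU|aU] := pselect (U (inf U)).
  rewrite (_ : A `&` _ = A `&` [set z | (inf U <= tau z)%R]); first exact: aU.2.
  apply/seteqP; split => z /= [Az Uz]; split => //; first exact: ge_inf.
  exact: Uup aU Uz.
have AUE : A `&` [set z | U (tau z)] =
    \bigcup_k (A `&` [set z | (t k <= tau z)%R]).
  apply/seteqP; split => z /=; last by move=> [k _ [Az tk]]; split => //; exact: Uup tk.
  move=> [Az Uz].
  have : (inf U < tau z)%R.
    rewrite lt_neqAle ge_inf// andbT; apply/eqP => E; apply: aU.
    by rewrite E.
  move=> /ltr_add_invr[k /ltW tk].
  by exists k.
rewrite AUE; have mtail k := measurable_tail_set (t k).
have := @nondecreasing_cvg_mu _ _ _ nu _ mtail (bigcupT_measurable _ mtail).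
have nd : nondecreasing_seq (fun k => A `&` [set z | (t k <= tau z)%R]).
  move=> i j ij; apply/subsetPset => z [Az tz]; split => //=.
  by apply: le_trans tz; rewrite lerD2l lef_pV2 ?posrE// ler_nat.
move=> /(_ nd) h; rewrite -(cvg_lim _ h)//.
apply: lime_le; first by apply/cvg_ex; eexists; exact: h.
by apply: nearW => k; exact: (Ut k).2.
Qed.

End upper_tail.

(** * Powers of a mass and integrals against its tails *)

Lemma le0_powR (R : realType) (a b r : R) : r <= 0 -> 0 < a -> a <= b ->
  b `^ r <= a `^ r.
Proof.
move=> r0 a0 ab; rewrite -[r]opprK !(powRN _ (- r)).
have b0 : 0 < b by exact: lt_le_trans ab.
rewrite lef_pV2 ?posrE ?powR_gt0//; apply: ge0_ler_powR => //.
- by rewrite oppr_ge0.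
- by rewrite nnegrE ltW.
- by rewrite nnegrE ltW.
Qed.

(** The power [s `^ (q - 1)] for [q <= 1], with the value [+oo] at [0] that makes it
    antitone, whereas [0 `^ (q - 1) = 0] for [q != 1]. *)
Definition neg_power (R : realType) (q : R) (s : \bar R) : \bar R :=
  (if s == 0 then +oo else s `^ (q - 1))%E.

Section neg_power.
Local Open Scope ereal_scope.
Context (R : realType) (q : R).
Hypothesis q1 : (q <= 1)%R.

Lemma neg_power_ge0 s : 0 <= neg_power q s.
Proof. by rewrite /neg_power; case: ifPn => // _; exact: poweR_ge0. Qed.

Lemma neg_power_antitone s t : 0 <= s -> s <= t -> t < +oo ->
  neg_power q t <= neg_power q s.
Proof.
rewrite /neg_power => s0 st too; case: ifPn => [/eqP t0|tn0].
  by rewrite (_ : s == 0) //; apply/eqP/le_anti; rewrite s0 -t0 st.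
case: ifPn => [_|sn0]; first exact: leey.
have {sn0}s0 : 0 < s by rewrite lt0e sn0.
case: s t s0 st too {tn0} => [s||] [t||] //.
rewrite lte_fin !lee_fin => s0 st _; apply: le0_powR => //.
by rewrite subr_le0.
Qed.

Lemma measurable_neg_power : measurable_fun setT (neg_power q).
Proof.
rewrite /neg_power; apply: measurable_fun_ifT => //.
- by apply: measurable_fun_eqe.
- exact: measurable_poweR.
Qed.

End neg_power.

Lemma le_of_eq d (T : porderType d) (x y : T) : x = y -> (x <= y)%O.
Proof. by move=> ->. Qed.

(** The sum of the geometric series met in [tail_neg_power_le]. *)
Definition tail_cst (R : realType) (q : R) : R :=
  2^-1 `^ (q - 1) / (1 - 2^-1 `^ q).

Lemma half_powR_lt1 (R : realType) (q : R) : 0 < q -> 2^-1 `^ q < 1.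
Proof.
move=> q0; have := @gt0_ltr_powR R q q0 2^-1 1; rewrite powR1; apply.
- by rewrite nnegrE invr_ge0.
- by rewrite nnegrE.
- by rewrite invf_lt1// ltr1n.
Qed.

Lemma tail_cst_gt0 (R : realType) (q : R) : 0 < q -> 0 < tail_cst q.
Proof.
by move=> q0; rewrite divr_gt0 ?powR_gt0 ?invr_gt0// subr_gt0 half_powR_lt1.
Qed.

Section tail_powers.
Local Open Scope ereal_scope.
Context d (T : measurableType d) (R : realType).
Variables (nu : {finite_measure set T -> \bar R}) (A : set T) (tau : T -> R).
Hypotheses (mA : measurable A) (mtau : measurable_fun setT tau)
  (tau0 : forall z, A z -> (0 < tau z)%R).
Local Notation G := (upper_tail nu A tau).

Let nuAE : exists2 m : R, (0 <= m)%R & nu A = m%:E.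
Proof.
exists (fine (nu A)); first exact: fine_ge0.
by rewrite fineK// fin_num_measure.
Qed.

Let mG : measurable_fun setT (fun z => G (tau z)).
Proof. exact: measurableT_comp (measurable_upper_tail _ _ _) _. Qed.

Let mGle s : measurable (A `&` [set z | G (tau z) <= s]).
Proof.
apply: measurableI => //.
have := @measurable_lee _ _ _ _ measurableT (fun z => G (tau z)) (cst s) mG
  (measurable_cst _).
by rewrite setTI.
Qed.

(** At least half of the mass lies where the tail is at least half of the total
    mass. *)
Lemma measure_power_le_tail (q : R) : (1 <= q)%R ->
  (nu A) `^ q <= (2 `^ q)%:E * \int[nu]_(z in A) (G (tau z)) `^ (q - 1).
Proof.
move=> q1; have [m m0 nuA] := nuAE; rewrite nuA.
have q0 : (0 < q)%R by exact: lt_le_trans q1.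
have [->|mn0] := eqVneq m 0%R.
  rewrite poweR0r ?gt_eqF//; apply: mule_ge0; first by rewrite lee_fin powR_ge0.
  by apply: integral_ge0 => z _; exact: poweR_ge0.
have {mn0 m0}m0 : (0 < m)%R by rewrite lt_neqAle eq_sym mn0.
pose B := A `&` [set z | G (tau z) <= (m / 2)%:E].
have mB : measurable B by exact: mGle.
have nuB : nu B <= (m / 2)%:E.
  by apply: upper_tail_small => //; rewrite lee_fin divr_ge0// ltW.
have nuD : (m / 2)%:E <= nu (A `\` B).
  rewrite measureD//; last by rewrite -ge0_fin_numE// fin_num_measure.
  rewrite (_ : A `&` B = B); last by apply/setIidPr => z [].
  rewrite [X in X - _](_ : _ = m%:E); last exact: nuA.
  have nuBE : nu B = (fine (nu B))%:E by rewrite fineK// fin_num_measure.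
  rewrite [X in _ - X](_ : _ = (fine (nu B))%:E); last exact: nuBE.
  by move: nuB; rewrite nuBE -EFinB !lee_fin /=; lra.
have {nuD}h : ((m / 2) `^ q)%:E <= \int[nu]_(z in A) (G (tau z)) `^ (q - 1).
  apply: (@le_trans _ _ (((m / 2) `^ (q - 1))%:E * nu (A `\` B))).
    apply: (@le_trans _ _ (((m / 2) `^ (q - 1))%:E * (m / 2)%:E)).
      by rewrite -EFinM [X in _ <= X%:E]mulrC mulr_powRB1// divr_ge0// ltW.
    by apply: lee_wpmul2l => //; rewrite lee_fin powR_ge0.
  rewrite -integral_cst; last exact: measurableD.
  apply: ge0_le_integral_sub.
  - by move=> z _; rewrite lee_fin powR_ge0.
  - by move=> z _; exact: poweR_ge0.
  move=> z [Az nBz]; split=> //; rewrite -poweR_EFin.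
  have Gz : (m / 2)%:E <= G (tau z).
    by rewrite leNgt; apply/negP => /ltW Gz; apply: nBz; split.
  apply: gt0_ler_poweR => //.
  - by rewrite subr_ge0.
  - by rewrite in_itv/= leey andbT lee_fin divr_ge0// ltW.
  - by rewrite in_itv/= leey andbT; apply: le_trans Gz; rewrite lee_fin divr_ge0// ltW.
apply: le_trans (lee_wpmul2l _ h); last by rewrite lee_fin powR_ge0.
rewrite -EFinM -powRM ?divr_ge0// ?(ltW m0)// mulrCA divff ?mulr1//.
Qed.

(** Split [A] according to the dyadic size of the tail: where [G] is about
    [m 2^-k] the integrand is at most [(m 2^-(k+1)) ^ (q - 1)], and this region has
    mass at most [m 2^-k]. The resulting series is geometric of ratio [2^-q]. *)
Lemma tail_neg_power_le (q : R) : (0 < q <= 1)%R ->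
  \int[nu]_(z in A) neg_power q (G (tau z)) <= (tail_cst q)%:E * (nu A) `^ q.
Proof.
move=> /andP[q0 q1]; have [m m0 nuA] := nuAE.
have G0 z : 0 <= G (tau z) by exact: measure_ge0.
have mPhi : measurable_fun setT (fun z => neg_power q (G (tau z))).
  exact: measurableT_comp (measurable_neg_power _) mG.
pose h : R := (2^-1)%R; pose u : R := (h `^ (q - 1))%R.
have h0 : (0 < h)%R by rewrite invr_gt0.
have hq1 : (h `^ q < 1)%R.
  exact: half_powR_lt1.
pose N := A `&` [set z | G (tau z) <= 0].
have mN : measurable N by exact: mGle.
have N0 : nu N = 0.
  by apply/eqP; rewrite eq_le measure_ge0 andbT; exact: upper_tail_small.
rewrite (ge0_negligible_integral mN)//; last 2 first.
- exact: measurable_funTS.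
- by move=> z _; exact: neg_power_ge0.
pose B k := A `&` [set z | G (tau z) <= (m * h ^+ k)%:E].
have mB k : measurable (B k) by exact: mGle.
pose c k : R := ((m * h ^+ k.+1) `^ (q - 1))%R.
have c0 k : (0 <= c k)%R by exact: powR_ge0.
apply: (@le_trans _ _ (\int[nu]_(z in A)
    \sum_(0 <= k <oo) ((c k)%:E * (\1_(B k) z)%:E))).
  apply: ge0_le_integral_sub.
  - by move=> z _; exact: neg_power_ge0.
  - by move=> z _; apply: nneseries_ge0 => k _ _; rewrite mule_ge0// lee_fin.
  move=> z [Az nNz]; split=> //.
  have Gz : 0 < G (tau z).
    by rewrite ltNge; apply/negP => Gz; apply: nNz; split.
  have := upper_tail_le nu mA mtau (tau z); rewrite nuA.
  rewrite /neg_power gt_eqF//.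
  have : B ^~ z = fun k => A z /\ G (tau z) <= (m * h ^+ k)%:E by [].
  case: (G (tau z)) Gz => [g| |]//; rewrite lte_fin => g0 Bz; rewrite lee_fin => gm.
  have : exists k, (m * h ^+ k.+1 < g)%R.
    have : (0 < g / (m + 1))%R by rewrite divr_gt0// ltr_wpDl.
    move=> /ltr_add_invr[k]; rewrite add0r ltr_pdivlMr ?ltr_wpDl// => kg.
    exists k; apply: le_lt_trans kg; rewrite mulrC; apply: ler_pM => //.
    - by rewrite exprn_ge0// ltW.
    - rewrite /h exprVn lef_pV2 ?posrE ?exprn_gt0// -natrX ler_nat.
      exact/ltnW/ltn_expl.
    - by rewrite lerDl.
  move=> /ex_minnP[k kg kmin].
  apply: (@le_trans _ _ ((c k)%:E * (\1_(B k) z)%:E)); last first.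
    apply: (@le_trans _ _ (\sum_(0 <= k < k.+1) ((c k)%:E * (\1_(B k) z)%:E))).
      rewrite big_nat_recr//= leeDr// sume_ge0// => i _.
      by rewrite mule_ge0// lee_fin.
    by apply: nneseries_lim_ge => i _ _; rewrite mule_ge0// lee_fin.
  rewrite indicE mem_set; last first.
    have -> : B k z = (A z /\ g%:E <= (m * h ^+ k)%:E).
      by rewrite -[LHS]/((B ^~ z) k) Bz.
    split=> //; rewrite lee_fin; case: k kg kmin => [|k] kg kmin.
      by rewrite expr0 mulr1.
    by rewrite leNgt; apply/negP => /kmin; rewrite ltnn.
  rewrite mule1 lee_fin; apply: le0_powR; rewrite ?subr_le0// ?ltW//.
  rewrite mulr_gt0 ?exprn_gt0//; exact: lt_le_trans gm.
rewrite integral_nneseries//; last 2 first.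
- move=> k; apply: measurable_funTS; apply: measurable_funeM.
  by apply/measurable_EFinP; exact: measurable_indic.
- by move=> k z _; rewrite mule_ge0// lee_fin.
apply: (@le_trans _ _ (\sum_(0 <= k <oo) (m `^ q * u * (h `^ q) ^+ k)%:E)).
  apply: lee_nneseries => k _.
    by move=> _; apply: integral_ge0 => z _; rewrite mule_ge0// lee_fin.
  rewrite ge0_integralZl//; last 2 first.
  - by apply/measurable_EFinP; exact: measurable_indic.
  - by rewrite lee_fin.
  rewrite integral_indic// (_ : B k `&` A = B k); last by apply/setIidPl => z [].
  apply: (@le_trans _ _ ((c k)%:E * (m * h ^+ k)%:E)).
    apply: lee_wpmul2l; first by rewrite lee_fin.
    apply: upper_tail_small => //; rewrite lee_fin mulr_ge0// exprn_ge0//.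
    exact: ltW.
  rewrite -EFinM lee_fin /c powRM// ?exprn_ge0// ?(ltW h0)//.
  have -> : ((h ^+ k.+1) `^ (q - 1) = u ^+ k.+1)%R.
    rewrite -(powR_mulrn _ (ltW h0)) -powRrM mulrC powRrM powR_mulrn//.
    exact: powR_ge0.
  rewrite -(mulr_powRB1 m0 q0) -(mulr_powRB1 (ltW h0) q0) -/u exprMn exprS.
  apply: le_of_eq; ring.
have C0 : (0 <= m `^ q * u)%R by rewrite mulr_ge0// powR_ge0.
apply: lime_le.
  by apply: is_cvg_nneseries => k _ _; rewrite lee_fin mulr_ge0// exprn_ge0// powR_ge0.
apply: nearW => k; rewrite sumEFin nuA -EFinM lee_fin.
have hq0 : (0 < h `^ q)%R by exact: powR_gt0.
have := @geometric_le_lim R k _ _ C0 hq0.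
rewrite ger0_norm ?(ltW hq0)// => /(_ hq1); rewrite /series /geometric /=.
move=> /le_trans; apply; rewrite /tail_cst -/h -/u.
by apply: le_of_eq; ring.
Qed.

End tail_powers.

(** * Comparison of integrals over cones *)

Section cones.
Context {R : realType} {n : nat}.
Implicit Types (x y : euclid R n) (z : spacetime R n) (a b t : R).

Definition cone a x : set (spacetime R n) :=
  [set z | eball x (a * (z.1 : R)) z.2].

Lemma cone_gt0 a x z : 0 < a -> cone a x z -> 0 < (z.1 : R).
Proof. by move=> a0 /eball_gt0; rewrite pmulr_rgt0. Qed.

Lemma subset_cone a b x : 0 < a -> a <= b -> cone a x `<=` cone b x.
Proof.
move=> a0 ab z xz; have z0 := cone_gt0 a0 xz.
by apply: lt_le_trans xz _; rewrite ler_wpM2r// ltW.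
Qed.

Definition cone_graph a : set (euclid R n * spacetime R n) :=
  [set u | cone a u.1 u.2].

Lemma measurable_cone_graph a : measurable (cone_graph a).
Proof.
have mfst : measurable_fun setT (fun u : euclid R n * spacetime R n => u.1).
  exact: measurable_fst.
have my : measurable_fun setT (fun u : euclid R n * spacetime R n => u.2.2).
  exact: (measurableT_comp measurable_snd measurable_snd).
have mt : measurable_fun setT (fun u : euclid R n * spacetime R n => u.2.1 : R).
  exact: (measurableT_comp measurable_fst measurable_snd).
have := @measurable_fun_ltr _ _ R setT _ (fun u => a * u.2.1)
  (measurable_eudist mfst my) (measurable_funM (measurable_cst _) mt).
move=> /(_ measurableT [set true]); rewrite setTI; exact.
Qed.

Lemma measurable_cone a x : measurable (cone a x).
Proof.
have := measurable_xsection x (measurable_cone_graph a).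
by congr measurable; apply/seteqP; split => z; rewrite xsectionE.
Qed.

Variable nu : {finite_measure set (spacetime R n) -> \bar R}.

Definition cone_mass a x : \bar R := nu (cone a x).

Lemma measurable_cone_mass a : measurable_fun setT (cone_mass a).
Proof.
have := measurable_fun_xsection nu (measurable_cone_graph a).
congr measurable_fun; apply/funext => x; rewrite /= /cone_mass; congr (nu _).
by apply/seteqP; split => z; rewrite xsectionE.
Qed.

Lemma cone_mass_fin a x : cone_mass a x \is a fin_num.
Proof. by apply: fin_num_measure; exact: measurable_cone. Qed.

Lemma cone_mass_ge0 a x : (0 <= cone_mass a x)%E.
Proof. exact: measure_ge0. Qed.

Lemma cone_mass_le a b x : 0 < a -> a <= b ->
  (cone_mass a x <= cone_mass b x)%E.
Proof.
move=> a0 ab; apply: le_measure; rewrite ?inE; last exact: subset_cone.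
- exact: measurable_cone.
- exact: measurable_cone.
Qed.

Definition cone_tail a (u : euclid R n * measurableTypeR R) : \bar R :=
  upper_tail nu (cone a u.1) (fun z => z.1 : R) u.2.

Lemma measurable_cone_tail a : measurable_fun setT (cone_tail a).
Proof.
pose P : set ((euclid R n * measurableTypeR R) * spacetime R n) :=
  [set v | cone a v.1.1 v.2 /\ ((v.1.2 : R) <= v.2.1)%R].
suff mP : measurable P.
  have := measurable_fun_xsection nu mP.
  congr measurable_fun; apply/funext => -[x t]; rewrite /= /cone_tail /upper_tail /=.
  by congr (nu _); apply/seteqP; split => z; rewrite xsectionE.
rewrite (_ : P = ((fun v => (v.1.1, v.2)) @^-1` cone_graph a) `&`
    [set v | (v.1.2 : R) <= v.2.1]); last by apply/seteqP; split.
apply: measurableI.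
  rewrite -[X in measurable X]setTI.
  have m : measurable_fun setT (fun v : (euclid R n * measurableTypeR R) *
      spacetime R n => (v.1.1, v.2)).
    apply/measurable_fun_pairP; split; last exact: measurable_snd.
    exact: (measurableT_comp measurable_fst measurable_fst).
  exact: (m measurableT _ (measurable_cone_graph a)).
have mt : measurable_fun setT (fun v : (euclid R n * measurableTypeR R) *
      spacetime R n => v.1.2 : R).
  exact: (measurableT_comp measurable_snd measurable_fst).
have mt' : measurable_fun setT (fun v : (euclid R n * measurableTypeR R) *
      spacetime R n => v.2.1 : R).
  exact: (measurableT_comp measurable_fst measurable_snd).
have := measurable_fun_ler mt mt'.
move=> /(_ measurableT [set true]); rewrite setTI; exact.
Qed.

Lemma cone_tail_le a x t : (cone_tail a (x, t) <= cone_mass a x)%E.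
Proof.
by apply: upper_tail_le; [exact: measurable_cone|exact: measurable_fst].
Qed.

Lemma cone_tail_ge0 a u : (0 <= cone_tail a u)%E.
Proof. exact: measure_ge0. Qed.

Lemma cone_tail_fin a u : cone_tail a u \is a fin_num.
Proof.
apply: fin_num_measure; apply: measurable_tail_set; first exact: measurable_cone.
exact: measurable_fst.
Qed.

(** A point [z] of the cone above [x] at height at least [t] satisfies
    [|x' - z.2| < a t + b z.1 <= (a + b) z.1]. *)
Lemma cone_tail_shift a b x x' t : 0 <= a -> eudist x x' < a * t ->
  (cone_tail b (x, t) <= cone_tail (a + b) (x', t))%E.
Proof.
move=> a0 xx'.
have mfst : measurable_fun setT (fun z : spacetime R n => z.1 : R).
  exact: measurable_fst.
apply: le_measure; rewrite ?inE.
- by apply: measurable_tail_set; [exact: measurable_cone|].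
- by apply: measurable_tail_set; [exact: measurable_cone|].
move=> z [] /= xz tz; split=> //=.
rewrite /cone /= eballE /= in xz *.
apply: le_lt_trans (eudist_triangle x' x z.2) _; rewrite eudistC mulrDl.
by apply: ltrD => //; apply: lt_le_trans xx' _; rewrite ler_wpM2l.
Qed.

Local Notation leb := (lebesgue_tuple R n).

(** The ratio of the upper bound on the volume of a ball of radius [c r] to the
    lower bound on the volume of a ball of radius [r]. *)
Definition volume_cst (c : R) : R := (2 * n%:R * c) ^+ n.

Lemma volume_cst_ge0 c : 0 <= c -> 0 <= volume_cst c.
Proof. by move=> c0; rewrite exprn_ge0// mulr_ge0// mulr_ge0. Qed.

Lemma ball_average_le (F F' : euclid R n -> \bar R) (y : euclid R n) (r r' : R) :
  0 < r -> 0 < r' ->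
  (forall x, 0 <= F x)%E -> (forall x, 0 <= F' x)%E ->
  (forall x x', eball y r x -> eball y r' x' -> (F x <= F' x')%E) ->
  (\int[leb]_(x in eball y r) F x <=
   (volume_cst (r / r'))%:E * \int[leb]_(x in eball y r') F' x)%E.
Proof.
move=> r0 r'0 F0 F'0 FF'.
(* the supremum of F separates F on the first ball from F' on the second one *)
set s := ereal_sup [set F x | x in eball y r].
have Fs x : eball y r x -> (F x <= s)%E.
  by move=> yx; apply: ereal_sup_ubound; exists x.
have yy : eball y r y.
  rewrite eballE /= /eudist big1 ?sqrtr0// => i _; by rewrite subrr expr0n.
have s0 : (0 <= s)%E by apply: le_trans (Fs y yy).
have sF' x : eball y r' x -> (s <= F' x)%E.
  by move=> yx; apply: ge_ereal_sup => _ [x' yx' <-]; exact: FF'.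
apply: (@le_trans _ _ (\int[leb]_(x in eball y r) cst s x)%E).
  by apply: ge0_le_integral_sub => //= x yx; split => //; exact: Fs.
rewrite integral_cst; last exact: measurable_eball.
apply: (@le_trans _ _ (s * ((2 * r) ^+ n)%:E)%E).
  by apply: lee_wpmul2l => //; apply: eball_volume_le; exact: ltW.
have -> : ((2 * r) ^+ n = volume_cst (r / r') * (r' / n%:R) ^+ n)%R.
  rewrite /volume_cst -exprMn.
  have [n0|n0] := eqVneq n 0%N; first by rewrite !(congr1 (fun k => _ ^+ k) n0).
  by congr (_ ^+ _); field; rewrite pnatr_eq0 n0 gt_eqF.
have c0 : (0 <= volume_cst (r / r'))%R.
  by apply: volume_cst_ge0; rewrite divr_ge0// ltW.
rewrite EFinM muleCA; apply: lee_wpmul2l; first by rewrite lee_fin.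
apply: (@le_trans _ _ (s * leb (eball y r'))%E).
  by apply: lee_wpmul2l => //; exact: eball_volume_ge.
rewrite -integral_cst; last exact: measurable_eball.
by apply: ge0_le_integral_sub => //= x yx; split => //; exact: sF'.
Qed.

Let on_cone a (F : euclid R n * measurableTypeR R -> \bar R) :=
  (fun u : euclid R n * spacetime R n => F (u.1, u.2.1)) \_ (cone_graph a).

Let measurable_on_cone a F : measurable_fun setT F ->
  measurable_fun setT (on_cone a F).
Proof.
move=> mF; have h := measurable_restrictT
  (fun u : euclid R n * spacetime R n => F (u.1, u.2.1))
  (measurable_cone_graph a).
apply: h.1.
apply: measurable_funTS; apply: measurableT_comp => //.
apply/measurable_fun_pairP; split; first exact: measurable_fst.
exact: (measurableT_comp measurable_fst measurable_snd).
Qed.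

Let on_cone_ge0 a F u : (forall u, 0 <= F u)%E -> (0 <= on_cone a F u)%E.
Proof. by move=> F0; rewrite /on_cone patchE; case: ifPn. Qed.

Let on_cone_integral_space a F z :
  (\int[leb]_x on_cone a F (x, z) =
   \int[leb]_(x in eball z.2 (a * (z.1 : R))) F (x, z.1))%E.
Proof.
rewrite [RHS]integral_mkcond; apply: eq_integral => x _.
rewrite /on_cone !patchE.
rewrite (_ : ((x, z) \in cone_graph a) = (x \in eball z.2 (a * (z.1 : R))))//.
by apply/idP/idP; rewrite !inE => /eball_sym.
Qed.

Lemma measurable_cone_integral a F :
  measurable_fun setT F -> (forall u, 0 <= F u)%E ->
  measurable_fun setT
    (fun x => \int[nu]_(z in cone a x) F (x, z.1))%E.
Proof.
move=> mF F0.
have := @measurable_fun_fubini_tonelli_F _ _ _ _ _ nu _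
  (measurable_on_cone a mF) (fun u => on_cone_ge0 a u F0).
congr measurable_fun; apply/funext => x; rewrite /fubini_F [RHS]integral_mkcond.
apply: eq_integral => z _; rewrite /on_cone !patchE.
by rewrite (_ : ((x, z) \in cone_graph a) = (z \in cone a x)).
Qed.

Lemma cone_integral_swap a F :
  measurable_fun setT F -> (forall u, 0 <= F u)%E ->
  (\int[leb]_x \int[nu]_(z in cone a x) F (x, z.1) =
   \int[nu]_z \int[leb]_(x in eball z.2 (a * (z.1 : R))) F (x, z.1))%E.
Proof.
move=> mF F0.
transitivity (\int[leb]_x \int[nu]_z on_cone a F (x, z))%E.
  apply: eq_integral => x _; rewrite integral_mkcond; apply: eq_integral => z _.
  rewrite /on_cone !patchE.
  by rewrite (_ : ((x, z) \in cone_graph a) = (z \in cone a x)).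
rewrite fubini_tonelli//; last 2 first.
- exact: measurable_on_cone.
- by move=> u; exact: on_cone_ge0.
by apply: eq_integral => z _; exact: on_cone_integral_space.
Qed.

Let measurable_ball_integral a F :
  measurable_fun setT F -> (forall u, 0 <= F u)%E ->
  measurable_fun setT
    (fun z => \int[leb]_(x in eball z.2 (a * (z.1 : R))) F (x, z.1))%E.
Proof.
move=> mF F0.
have := @measurable_fun_fubini_tonelli_G _ _ _ _ _ leb _
  (measurable_on_cone a mF) (fun u => on_cone_ge0 a u F0).
by congr measurable_fun; apply/funext => z; exact: on_cone_integral_space.
Qed.

(** By Tonelli both sides are integrals over [z] of integrals over the balls of
    radii [b z.1] and [a z.1] around [z.2]; any two points of these balls are at
    distance less than [(a + b) z.1], so the supremum of [F] over the first ball
    is a lower bound of [F'] on the second one. *)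
Lemma cone_integral_compare a b (F F' : euclid R n * measurableTypeR R -> \bar R) :
  0 < a -> 0 < b ->
  measurable_fun setT F -> (forall u, 0 <= F u)%E ->
  measurable_fun setT F' -> (forall u, 0 <= F' u)%E ->
  (forall x x' t, eudist x x' < (a + b) * t -> (F (x, t) <= F' (x', t))%E) ->
  (\int[leb]_x \int[nu]_(z in cone b x) F (x, z.1) <=
   (volume_cst (b / a))%:E *
     \int[leb]_x \int[nu]_(z in cone a x) F' (x, z.1))%E.
Proof.
move=> a0 b0 mF F0 mF' F'0 FF'.
have c0 : (0 <= volume_cst (b / a))%R.
  by apply: volume_cst_ge0; rewrite divr_ge0// ltW.
rewrite !cone_integral_swap// -ge0_integralZl; last 4 first.
- by [].
- exact: (measurable_ball_integral a mF' F'0).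
- by move=> z _; exact: integral_ge0.
- by rewrite lee_fin.
apply: ge0_le_integral_sub => //.
- by move=> z _; exact: integral_ge0.
- by move=> z _; rewrite mule_ge0 ?lee_fin//; exact: integral_ge0.
move=> z _; split=> //.
have [t0|t0] := leP (z.1 : R) 0.
  rewrite (_ : eball z.2 (b * (z.1 : R)) = set0).
    by rewrite integral_set0 mule_ge0 ?lee_fin//; exact: integral_ge0.
  apply/seteqP; split => x // /eball_gt0; rewrite pmulr_rgt0// => t1.
  by move: (lt_le_trans t1 t0); rewrite ltxx.
have -> : b / a = b * (z.1 : R) / (a * (z.1 : R)) by field; rewrite !gt_eqF.
apply: (ball_average_le (F := fun x => F (x, z.1))
  (F' := fun x => F' (x, z.1))) => //.
- by rewrite mulr_gt0.
- by rewrite mulr_gt0.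
move=> x x' yx yx'; apply: FF'.
apply: le_lt_trans (eudist_triangle x z.2 x') _; rewrite mulrDl addrC.
by apply: ltrD => //; rewrite eudistC.
Qed.

End cones.

Arguments volume_cst {R} n c.

(** * Mixed estimates between two apertures *)

Section aperture_power.
Context {R : realType} {n : nat}.
Variable nu : {finite_measure set (spacetime R n) -> \bar R}.
Implicit Types (a b q : R).

Local Notation leb := (lebesgue_tuple R n).
Local Notation S := (cone_mass nu).
Local Notation G := (cone_tail nu).

Definition area_power q a : \bar R := (\int[leb]_x (S a x) `^ q)%E.

Lemma area_power_ge0 q a : (0 <= area_power q a)%E.
Proof. by apply: integral_ge0 => x _; exact: poweR_ge0. Qed.

Lemma measurable_cone_mass_power q a :
  measurable_fun setT (fun x => S a x `^ q)%E.
Proof.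
exact: (measurableT_comp (measurable_poweR _) (measurable_cone_mass _ _)).
Qed.

Lemma poweR_le q (s t : \bar R) : 0 <= q -> (0 <= s)%E -> (s <= t)%E ->
  (s `^ q <= t `^ q)%E.
Proof.
move=> q0 s0 st; apply: gt0_ler_poweR => //; rewrite in_itv/= leey andbT//.
exact: le_trans st.
Qed.

Lemma area_power_le q a b : 0 <= q -> 0 < a -> a <= b ->
  (area_power q a <= area_power q b)%E.
Proof.
move=> q0 a0 ab; apply: ge0_le_integral_sub => //= x _.
- exact: poweR_ge0.
- exact: poweR_ge0.
by split => //; apply: poweR_le => //; exact: cone_mass_le.
Qed.

Let mheight : measurable_fun setT (fun z : spacetime R n => z.1 : R).
Proof. exact: measurable_fst. Qed.

(** Replace [S_b ^ q] by the integral of [G_b ^ (q - 1)] over the cone, pass to the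
    cone of aperture [a] at the price of enlarging the aperture of the tail, and
    bound the tail by the whole mass. *)
Lemma area_power_mixed_ge1 q a b : 1 <= q -> 0 < a -> 0 < b ->
  (area_power q b <= (2 `^ q * volume_cst n (b / a))%R%:E *
    \int[leb]_x (S a x * S (a + 2 * b)%R x `^ (q - 1)))%E.
Proof.
move=> q1 a0 b0.
have q10 : 0 <= q - 1 by rewrite subr_ge0.
pose F c (u : euclid R n * measurableTypeR R) := (G c u `^ (q - 1))%E.
have mF c : measurable_fun setT (F c).
  exact: (measurableT_comp (measurable_poweR _) (measurable_cone_tail _ _)).
have F0 c u : (0 <= F c u)%E by exact: poweR_ge0.
apply: (@le_trans _ _ ((2 `^ q)%:E *
    \int[leb]_x \int[nu]_(z in cone b x) F b (x, z.1))%E).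
  rewrite -ge0_integralZl; last 4 first.
  - by [].
  - exact: measurable_cone_integral.
  - by move=> x _; exact: integral_ge0.
  - by rewrite lee_fin powR_ge0.
  apply: ge0_le_integral_sub.
  - by move=> x _; exact: poweR_ge0.
  - move=> x _; rewrite mule_ge0 ?lee_fin ?powR_ge0//.
    exact: integral_ge0.
  move=> x _; split => //.
  exact: (measure_power_le_tail nu (measurable_cone b x) mheight
    (fun z => cone_gt0 b0) q1).
rewrite EFinM -muleA; apply: lee_wpmul2l; first by rewrite lee_fin powR_ge0.
apply: (@le_trans _ _ ((volume_cst n (b / a))%:E *
    \int[leb]_x \int[nu]_(z in cone a x) F (a + 2 * b)%R (x, z.1))%E).
  apply: cone_integral_compare => // x x' t xx'.
  apply: poweR_le => //.
  rewrite (_ : a + 2 * b = (a + b) + b); last by ring.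
  by apply: cone_tail_shift => //; rewrite addr_ge0// ltW.
apply: lee_wpmul2l.
  by rewrite lee_fin volume_cst_ge0// divr_ge0// ltW.
apply: ge0_le_integral_sub.
- by move=> x _; exact: integral_ge0.
- by move=> x _; rewrite mule_ge0 ?poweR_ge0 ?cone_mass_ge0.
move=> x _; split => //; rewrite muleC -integral_cst; last exact: measurable_cone.
apply: ge0_le_integral_sub.
- by [].
- by move=> z _; exact: poweR_ge0.
move=> z az; split => //; rewrite /F /=; apply: poweR_le => //.
exact: cone_tail_le.
Qed.

(** The mirror image of the previous estimate: the negative power reverses the
    inequalities between tails, hence the tail with the larger aperture now stands
    on the left. *)
Lemma area_power_mixed_le1 q a b : 0 < q <= 1 -> 0 < a -> 0 < b ->
  (\int[leb]_x (S b x * neg_power q (S (b + 2 * a)%R x)) <=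
    (volume_cst n (b / a) * tail_cst q)%R%:E * area_power q a)%E.
Proof.
move=> /andP[q0 q1] a0 b0.
pose F c (u : euclid R n * measurableTypeR R) := neg_power q (G c u).
have mF c : measurable_fun setT (F c).
  exact: (measurableT_comp (measurable_neg_power _) (measurable_cone_tail _ _)).
have F0 c u : (0 <= F c u)%E by exact: neg_power_ge0.
apply: (@le_trans _ _
    (\int[leb]_x \int[nu]_(z in cone b x) F (b + 2 * a)%R (x, z.1))%E).
  apply: ge0_le_integral_sub.
  - by move=> x _; rewrite mule_ge0 ?neg_power_ge0 ?cone_mass_ge0.
  - by move=> x _; exact: integral_ge0.
  move=> x _; split => //; rewrite muleC -integral_cst; last exact: measurable_cone.
  apply: ge0_le_integral_sub.
  - by move=> z _; exact: neg_power_ge0.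
  - by [].
  move=> z bz; split => //; rewrite /F /=; apply: neg_power_antitone => //.
  - exact: cone_tail_le.
  - by rewrite -ge0_fin_numE ?cone_mass_ge0// cone_mass_fin.
apply: (@le_trans _ _ ((volume_cst n (b / a))%:E *
    \int[leb]_x \int[nu]_(z in cone a x) F a (x, z.1))%E).
  apply: cone_integral_compare => // x x' t xx'.
  rewrite /F; apply: neg_power_antitone => //.
    rewrite (_ : b + 2 * a = (a + b) + a); last by ring.
    by apply: cone_tail_shift; rewrite ?addr_ge0 1?ltW// eudistC.
  by rewrite -ge0_fin_numE ?cone_tail_ge0// cone_tail_fin.
rewrite EFinM -muleA; apply: lee_wpmul2l.
  by rewrite lee_fin volume_cst_ge0// divr_ge0// ltW.
rewrite -ge0_integralZl; last 4 first.
- by [].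
- exact: measurable_cone_mass_power.
- by move=> x _; exact: poweR_ge0.
- by rewrite lee_fin ltW// tail_cst_gt0.
apply: ge0_le_integral_sub.
- by move=> x _; exact: integral_ge0.
- by move=> x _; rewrite mule_ge0 ?poweR_ge0// lee_fin ltW// tail_cst_gt0.
move=> x _; split => //.
have q01 : 0 < q <= 1 by rewrite q0.
exact: (tail_neg_power_le nu (measurable_cone a x) mheight
  (fun z => cone_gt0 a0) q01).
Qed.

End aperture_power.

(** * Absorption and weighted inequalities *)

(** Boundedness of [f] makes its supremum [M0] over [b >= a] finite, and then
    [M0 <= M0 / 2 + A]. *)
Lemma absorb_half (R : realType) (f : R -> R) (a A M : R) : 0 < a ->
  (forall b, a <= b -> f b <= M) ->
  (forall b, a <= b -> f b <= f (3 * b) / 2 + A) ->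
  forall b, a <= b -> f b <= 2 * A.
Proof.
move=> a0 fM fA.
pose E := [set f b | b in [set b | a <= b]].
have E0 : E !=set0 by exists (f a); exists a => //=.
have hE : has_sup E by split=> //; exists M => _ [b ab <-]; exact: fM.
suff sA : sup E <= 2 * A.
  move=> b ab; apply: le_trans sA; apply: ub_le_sup; first exact: hE.2.
  by exists b.
suff : sup E <= sup E / 2 + A by lra.
apply: ge_sup => // _ [b ab <-]; apply: le_trans (fA _ ab) _.
rewrite lerD2r ler_wpM2r//; apply: ub_le_sup; first exact: hE.2.
by exists (3 * b) => //=; move: ab => /=; lra.
Qed.

Section weighted_power_bounds.
Context {R : realType}.
Implicit Types (q s t d : R).

(** Compare [s] with [d t]: one of the two terms on the right dominates alone. *)
Lemma mixed_power_ge1 q s t d : 1 <= q -> 0 <= s -> 0 <= t -> 0 < d ->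
  s * t `^ (q - 1) <= d * t `^ q + d `^ (1 - q) * s `^ q.
Proof.
move=> q1 s0 t0 d0; have q0 : 0 < q by exact: lt_le_trans q1.
have [sdt|dts] := leP s (d * t).
  apply: (@le_trans _ _ (d * t `^ q)); last first.
    by rewrite lerDl mulr_ge0// powR_ge0.
  rewrite -(mulr_powRB1 t0 q0) mulrA ler_wpM2r// powR_ge0//.
apply: (@le_trans _ _ (d `^ (1 - q) * s `^ q)); last first.
  by rewrite lerDr mulr_ge0 ?powR_ge0// ltW.
rewrite -(mulr_powRB1 s0 q0) mulrCA ler_wpM2l//.
have -> : d `^ (1 - q) * s `^ (q - 1) = (s / d) `^ (q - 1).
  rewrite powRM ?invr_ge0 ?(ltW d0)// mulrC; congr (_ * _).
  by rewrite -powR_inv1 ?(ltW d0)// -powRrM; congr (_ `^ _); ring.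
apply: ge0_ler_powR; rewrite ?nnegrE ?subr_ge0 ?divr_ge0 ?(ltW d0)//.
by rewrite ler_pdivlMr// mulrC ltW.
Qed.

(** Compare [s] with [d ^ (1/q) t]: if it is smaller the first term dominates;
    otherwise [t] is so small compared with [s] that the negative power of [t] makes
    the second term dominate. *)
Lemma mixed_power_le1 q s t d : 0 < q <= 1 -> 0 <= s -> s <= t -> 0 < d ->
  ((s `^ q)%:E <= (d * t `^ q)%:E +
    (d `^ (- ((1 - q) / q)))%:E * (s%:E * neg_power q t%:E))%E.
Proof.
move=> /andP[q0 q1] s0 st d0; have t0 : 0 <= t by exact: le_trans st.
(* the threshold for which (d ^ (1/q) t) ^ q = d t ^ q *)
have [sdt|dts] := leP s (d `^ q^-1 * t).
  rewrite -[leLHS]adde0; apply: leeD; last first.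
    by rewrite mule_ge0 ?lee_fin ?powR_ge0// mule_ge0 ?lee_fin ?neg_power_ge0.
  rewrite lee_fin; apply: (@le_trans _ _ ((d `^ q^-1 * t) `^ q)).
    by apply: ge0_ler_powR; rewrite ?nnegrE ?(ltW q0)// mulr_ge0// powR_ge0.
  by rewrite powRM ?powR_ge0// -powRrM mulVf ?gt_eqF// powRr1 ?(ltW d0).
have sp : 0 < s by apply: le_lt_trans dts; rewrite mulr_ge0// powR_ge0.
have tp : 0 < t by exact: lt_le_trans st.
rewrite -[leLHS]add0e; apply: leeD.
  by rewrite lee_fin mulr_ge0 ?powR_ge0// ltW.
rewrite /neg_power gt_eqF ?lte_fin// poweR_EFin -!EFinM lee_fin.
rewrite -(mulr_powRB1 s0 q0) mulrCA ler_wpM2l//.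
have -> : s `^ (q - 1) = d `^ (- ((1 - q) / q)) * (s / d `^ q^-1) `^ (q - 1).
  rewrite powRM ?invr_ge0 ?powR_ge0// -(powR_inv1 (powR_ge0 d q^-1)).
  rewrite -!powRrM mulrCA -powRD.
    rewrite (_ : - ((1 - q) / q) + q^-1 * (-1 * (q - 1)) = 0) ?powRr0 ?mulr1//.
    by field; rewrite gt_eqF.
  by apply/implyP => _; rewrite gt_eqF.
rewrite ler_wpM2l ?powR_ge0//; apply: le0_powR => //.
  by rewrite subr_le0.
by rewrite ler_pdivlMr ?powR_gt0// mulrC ltW.
Qed.

End weighted_power_bounds.

(** * Change of aperture for finite measures of bounded support *)

Section aperture_constants.
Context {R : realType}.
Variables (n : nat) (q : R).

Definition mixed_cst : R := 2 `^ q * (2 * n%:R) ^+ n.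

Definition shrink_ge1_cst : R := mixed_cst * 2 ^+ n + 4 ^+ n.

Definition enlarge_ge1_cst : R :=
  2 * (mixed_cst * (2 * mixed_cst * 3 `^ (n%:R * q)) `^ (q - 1)).

Definition enlarge_le1_cst : R :=
  2 * ((2 * 3 ^+ n)^-1 `^ (- ((1 - q) / q)) * ((2 * n%:R) ^+ n * tail_cst q)).

Definition shrink_le1_cst : R :=
  3 ^+ n * enlarge_le1_cst + (2 * n%:R) ^+ n * tail_cst q.

Definition aperture_cst : R :=
  1 + (shrink_ge1_cst + enlarge_ge1_cst) + (enlarge_le1_cst + shrink_le1_cst).

Hypothesis q_gt0 : 0 < q.

Lemma mixed_cst_ge0 : 0 <= mixed_cst.
Proof. by rewrite mulr_ge0 ?powR_ge0// exprn_ge0// mulr_ge0. Qed.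

Lemma shrink_ge1_cst_ge0 : 0 <= shrink_ge1_cst.
Proof. by rewrite addr_ge0 ?exprn_ge0// mulr_ge0 ?mixed_cst_ge0// exprn_ge0. Qed.

Lemma enlarge_ge1_cst_ge0 : 0 <= enlarge_ge1_cst.
Proof. by rewrite mulr_ge0// mulr_ge0 ?mixed_cst_ge0// powR_ge0. Qed.

Let volume_tail_ge0 : 0 <= (2 * n%:R) ^+ n * tail_cst q.
Proof.
by apply: mulr_ge0; [rewrite exprn_ge0// mulr_ge0|exact/ltW/tail_cst_gt0].
Qed.

Lemma enlarge_le1_cst_ge0 : 0 <= enlarge_le1_cst.
Proof. by apply: mulr_ge0 => //; apply: mulr_ge0 => //; exact: powR_ge0. Qed.

Lemma shrink_le1_cst_ge0 : 0 <= shrink_le1_cst.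
Proof.
apply: addr_ge0 => //; apply: mulr_ge0; first by rewrite exprn_ge0.
exact: enlarge_le1_cst_ge0.
Qed.

Lemma aperture_cst_gt0 : 0 < aperture_cst.
Proof.
have h1 := shrink_ge1_cst_ge0; have h2 := enlarge_ge1_cst_ge0.
have h3 := enlarge_le1_cst_ge0; have h4 := shrink_le1_cst_ge0.
by rewrite /aperture_cst; lra.
Qed.

End aperture_constants.

(** A bounded support makes all the powers [X_a] finite and gives them the
    polynomial growth in [a] that the absorption argument needs. *)
Section aperture_bounded_support.
Context {R : realType} {n : nat}.
Variable nu : {finite_measure set (spacetime R n) -> \bar R}.
Variables (x0 : euclid R n) (K : R).
Hypothesis n_gt0 : (0 < n)%N.
Hypothesis K_gt0 : 0 < K.
Hypothesis nu_support : forall A : set (spacetime R n),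
  (forall z, A z -> (z.1 : R) <= K -> ~ eball x0 K z.2) -> nu A = 0%E.
Implicit Types (a b q d e : R).

Local Notation leb := (lebesgue_tuple R n).
Local Notation S := (cone_mass nu).

Let V : R := fine (nu setT).

Let V_ge0 : 0 <= V. Proof. exact: fine_ge0. Qed.

Let S_le a x : (S a x <= V%:E)%E.
Proof.
rewrite /V fineK; last by rewrite fin_num_measure.
by apply: le_measure; rewrite ?inE//; exact: measurable_cone.
Qed.

Let S_eq0 a x : 0 < a -> ~ eball x0 (K * (1 + a)) x -> S a x = 0%E.
Proof.
move=> a0 xN; apply: nu_support => z az zK zx; apply: xN.
rewrite eballE /=; apply: le_lt_trans (eudist_triangle x0 z.2 x) _.
rewrite mulrDr mulr1; apply: ltrD => //; rewrite eudistC.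
by apply: lt_le_trans az _; rewrite mulrC ler_wpM2r// ltW.
Qed.

Lemma area_power_growth q a : 0 < q -> 0 < a ->
  (area_power nu q a <= (V `^ q * (2 * (K * (1 + a))) ^+ n)%:E)%E.
Proof.
move=> q0 a0; have Ka : 0 < K * (1 + a) by rewrite mulr_gt0// addr_gt0.
apply: (@le_trans _ _ (\int[leb]_(x in eball x0 (K * (1 + a))) (V `^ q)%:E)%E).
  rewrite [leRHS]integral_mkcond; apply: ge0_le_integral_sub.
  - by move=> x _; exact: poweR_ge0.
  - by move=> x _; apply: erestrict_ge0 => y _; rewrite lee_fin powR_ge0.
  move=> x _; split => //; rewrite patchE; case: ifPn.
    move=> _; rewrite -poweR_EFin; apply: poweR_le (S_le a x); first exact: ltW.
    exact: cone_mass_ge0.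
  by rewrite notin_setE => xN; rewrite S_eq0// poweR0r// gt_eqF.
rewrite integral_cst; last exact: measurable_eball.
rewrite EFinM; apply: lee_wpmul2l; first by rewrite lee_fin powR_ge0.
by apply: eball_volume_le; exact: ltW.
Qed.

Let P q a : R := fine (area_power nu q a).

Let PE q a : 0 < q -> 0 < a -> area_power nu q a = (P q a)%:E.
Proof.
move=> q0 a0; rewrite /P fineK// ge0_fin_numE ?area_power_ge0//.
exact: le_lt_trans (area_power_growth q0 a0) (ltry _).
Qed.

Let P_ge0 q a : 0 <= P q a.
Proof. by apply: fine_ge0; exact: area_power_ge0. Qed.

Let P_le q a b : 0 < q -> 0 < a -> a <= b -> P q a <= P q b.
Proof.
move=> q0 a0 ab; rewrite -lee_fin -!PE//; last exact: lt_le_trans ab.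
by apply: area_power_le => //; exact: ltW.
Qed.

(** The cone masses are bounded and vanish outside a ball of radius [K (1 + b)],
    so that [X_b] grows at most like [b ^ n]. *)
Let P_growth q e a : 0 < q -> n%:R <= e -> 0 < a ->
  exists M, forall b, a <= b -> P q b / b `^ e <= M.
Proof.
move=> q0 ne a0.
exists (V `^ q * (2 * (K * (a^-1 + 1))) ^+ n * a `^ (n%:R - e)) => b ab.
have b0 : 0 < b by exact: lt_le_trans ab.
rewrite ler_pdivrMr ?powR_gt0//.
have := area_power_growth q0 b0; rewrite PE// lee_fin => /le_trans; apply.
rewrite -!mulrA ler_wpM2l ?powR_ge0//.
apply: (@le_trans _ _ ((2 * (K * (a^-1 + 1))) ^+ n * b ^+ n)).
  rewrite -exprMn lerXn2r// ?nnegrE ?mulr_ge0 ?addr_ge0 ?invr_ge0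
    ?(ltW K_gt0) ?(ltW a0) ?(ltW b0)//.
  rewrite -!mulrA !ler_wpM2l ?(ltW K_gt0)// mulrDl mul1r lerD2r.
  by rewrite mulrC ler_pdivlMr// mul1r.
rewrite ler_wpM2l ?exprn_ge0 ?mulr_ge0 ?addr_ge0 ?invr_ge0 ?(ltW K_gt0) ?(ltW a0)//.
rewrite -(powR_mulrn _ (ltW b0)).
have -> : b `^ n%:R = b `^ (n%:R - e) * b `^ e.
  rewrite -powRD; last by apply/implyP => _; rewrite gt_eqF.
  by rewrite subrK.
by rewrite ler_wpM2r ?powR_ge0//; apply: le0_powR => //; rewrite subr_le0.
Qed.

Let mixed_ge1 q a b d : 1 <= q -> 0 < a -> a <= b -> 0 < d ->
  P q b <= 2 `^ q * volume_cst n (b / a) *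
    (d * P q (3 * b) + d `^ (1 - q) * P q a).
Proof.
move=> q1 a0 ab d0; have q0 : 0 < q by exact: lt_le_trans q1.
have b0 : 0 < b by exact: lt_le_trans ab.
have b30 : 0 < 3 * b by rewrite mulr_gt0.
rewrite -lee_fin -PE//; apply: le_trans (area_power_mixed_ge1 nu q1 a0 b0) _.
rewrite [leRHS]EFinM; apply: lee_wpmul2l.
  by rewrite lee_fin mulr_ge0 ?powR_ge0// volume_cst_ge0// divr_ge0// ltW.
rewrite EFinD !EFinM -!PE// /area_power -!ge0_integralZl//; last 6 first.
- exact: measurable_cone_mass_power.
- by move=> x _; exact: poweR_ge0.
- by rewrite lee_fin powR_ge0.
- exact: measurable_cone_mass_power.
- by move=> x _; exact: poweR_ge0.
- by rewrite lee_fin ltW.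
rewrite -ge0_integralD//; last 4 first.
- by move=> x _; rewrite mule_ge0 ?poweR_ge0// lee_fin ltW.
- by apply: measurable_funeM; exact: measurable_cone_mass_power.
- by move=> x _; rewrite mule_ge0 ?poweR_ge0// lee_fin powR_ge0.
- by apply: measurable_funeM; exact: measurable_cone_mass_power.
apply: ge0_le_integral_sub => // x _.
- by rewrite mule_ge0 ?poweR_ge0 ?cone_mass_ge0.
- by rewrite adde_ge0// mule_ge0 ?poweR_ge0// lee_fin ?powR_ge0 ?(ltW d0).
split=> //; apply: (@le_trans _ _ (S a x * S (3 * b)%R x `^ (q - 1))%E).
  apply: lee_wpmul2l; first exact: cone_mass_ge0.
  apply: poweR_le; rewrite ?subr_ge0 ?cone_mass_ge0//.
  by apply: cone_mass_le; lra.
have S0 c : 0 <= fine (S c x) by apply: fine_ge0; exact: cone_mass_ge0.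
have := @mixed_power_ge1 _ q _ _ d q1 (S0 a) (S0 (3 * b)) d0.
by rewrite -lee_fin !EFinD !EFinM -!fine_poweR !fineK ?fin_num_poweR ?cone_mass_fin.
Qed.

Let mixed_le1 q a b d : 0 < q <= 1 -> 0 < a -> 0 < b -> 0 < d ->
  P q b <= d * P q (b + 2 * a) +
    d `^ (- ((1 - q) / q)) * (volume_cst n (b / a) * tail_cst q * P q a).
Proof.
move=> q01 a0 b0 d0; have /andP[q0 q1] := q01.
have b20 : 0 < b + 2 * a by rewrite addr_gt0// mulr_gt0.
have mS c : measurable_fun setT (fun x => neg_power q (S c x)).
  exact: (measurableT_comp (measurable_neg_power _) (measurable_cone_mass _ _)).
rewrite -lee_fin -PE//.
apply: (@le_trans _ _ (d%:E * area_power nu q (b + 2 * a) +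
  (d `^ (- ((1 - q) / q)))%:E *
    \int[leb]_x (S b x * neg_power q (S (b + 2 * a)%R x)))%E); last first.
  rewrite EFinD; apply: leeD; first by rewrite PE// EFinM.
  rewrite EFinM; apply: lee_wpmul2l; first by rewrite lee_fin powR_ge0.
  by rewrite EFinM -PE//; exact: area_power_mixed_le1.
rewrite /area_power -!ge0_integralZl//; last 6 first.
- apply: emeasurable_funM; [exact: measurable_cone_mass|exact: mS].
- by move=> x _; rewrite mule_ge0 ?cone_mass_ge0 ?neg_power_ge0.
- by rewrite lee_fin powR_ge0.
- exact: measurable_cone_mass_power.
- by move=> x _; exact: poweR_ge0.
- by rewrite lee_fin ltW.
rewrite -ge0_integralD//; last 4 first.
- by move=> x _; rewrite mule_ge0 ?poweR_ge0// lee_fin ltW.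
- by apply: measurable_funeM; exact: measurable_cone_mass_power.
- move=> x _; rewrite mule_ge0 ?lee_fin ?powR_ge0//.
  by rewrite mule_ge0 ?cone_mass_ge0 ?neg_power_ge0.
- apply: measurable_funeM; apply: emeasurable_funM; last exact: mS.
  exact: measurable_cone_mass.
apply: ge0_le_integral_sub => // x _; first exact: poweR_ge0.
  rewrite adde_ge0// mule_ge0 ?poweR_ge0 ?lee_fin ?powR_ge0 ?(ltW d0)//.
  by rewrite mule_ge0 ?cone_mass_ge0 ?neg_power_ge0.
split=> //.
have S0 : 0 <= fine (S b x) by apply: fine_ge0; exact: cone_mass_ge0.
have SS : fine (S b x) <= fine (S (b + 2 * a) x).
  by apply: fine_le; rewrite ?cone_mass_fin// cone_mass_le//; lra.
have := @mixed_power_le1 _ q _ _ d q01 S0 SS d0.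
by rewrite EFinM -!fine_poweR !fineK ?fin_num_poweR ?cone_mass_fin.
Qed.

Let B_gt0 q : 0 < mixed_cst n q.
Proof. by rewrite mulr_gt0 ?powR_gt0// exprn_gt0// mulr_gt0// ltr0n. Qed.

Let mixed_cstE q a b : 2 `^ q * volume_cst n (b / a) = mixed_cst n q * (b / a) ^+ n.
Proof. by rewrite /volume_cst exprMn mulrA. Qed.

(** If [4 b <= a], the mixed estimate for [a - 2 b >= a / 2] only involves apertures
    at most [a]; if [4 b > a], monotonicity in the aperture is enough. *)
Let shrink_ge1 q a b : 1 <= q -> 0 < a -> 0 < b -> b <= a ->
  P q b <= shrink_ge1_cst n q * (b / a) ^+ n * P q a.
Proof.
move=> q1 a0 b0 ba; have q0 : 0 < q by exact: lt_le_trans q1.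
have ba0 : 0 <= (b / a) ^+ n by rewrite exprn_ge0// divr_ge0// ltW.
have [b4a|ab4] := leP (4 * b) a.
  apply: (@le_trans _ _ (mixed_cst n q * 2 ^+ n * (b / a) ^+ n * P q a)); last first.
    by rewrite ler_wpM2r// ler_wpM2r// lerDl exprn_ge0.
  have c0 : 0 < a - 2 * b by lra.
  rewrite -lee_fin -PE//.
  apply: le_trans (area_power_mixed_ge1 nu q1 c0 b0) _.
  rewrite subrK mixed_cstE [leRHS]EFinM -PE//.
  apply: (@le_trans _ _ ((mixed_cst n q * (b / (a - 2 * b)) ^+ n)%:E *
      area_power nu q a)%E).
    apply: lee_wpmul2l.
      by rewrite lee_fin mulr_ge0 ?(ltW (B_gt0 _))// exprn_ge0// divr_ge0// ltW.
    apply: ge0_le_integral_sub => // x _.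
    - by rewrite mule_ge0 ?poweR_ge0 ?cone_mass_ge0.
    - exact: poweR_ge0.
    split=> //; apply: (@le_trans _ _ (S a x * S a x `^ (q - 1))%E).
      apply: lee_wpmul2r; first exact: poweR_ge0.
      by apply: cone_mass_le => //; lra.
    have S0 : 0 <= fine (S a x) by apply: fine_ge0; exact: cone_mass_ge0.
    have := congr1 EFin (mulr_powRB1 S0 q0).
    by rewrite EFinM -!fine_poweR !fineK ?fin_num_poweR ?cone_mass_fin// => ->.
  apply: lee_wpmul2r; first exact: area_power_ge0.
  rewrite lee_fin -mulrA ler_wpM2l ?(ltW (B_gt0 _))// -exprMn lerXn2r//.
  - by rewrite nnegrE divr_ge0// ltW.
  - by rewrite nnegrE mulr_ge0// divr_ge0// ltW.
  rewrite mulrCA ler_wpM2l ?(ltW b0)// -[leRHS]invrK lef_pV2 ?posrE//.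
    by rewrite invfM invrK; lra.
  by rewrite invr_gt0 divr_gt0.
apply: (@le_trans _ _ (4 ^+ n * (b / a) ^+ n * P q a)); last first.
  rewrite ler_wpM2r// ler_wpM2r// lerDr mulr_ge0 ?exprn_ge0//.
  exact: ltW.
apply: le_trans (P_le q0 b0 ba) _; rewrite -[leLHS]mul1r ler_wpM2r// -exprMn.
by rewrite exprn_ege1// mulrA ler_pdivlMr// mul1r ltW.
Qed.

(** The weight [d] is chosen so that the coefficient of [X_(3c)] is half of
    [3 ^ (- n q)], which makes [X_c / c ^ (n q)] satisfy the hypothesis of
    [absorb_half]. *)
Let enlarge_ge1 q a b : 1 <= q -> 0 < a -> a <= b ->
  P q b <= enlarge_ge1_cst n q * (b / a) `^ (n%:R * q) * P q a.
Proof.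
move=> q1 a0 ab; have q0 : 0 < q by exact: lt_le_trans q1.
set N : R := n%:R * q.
have N_ge : n%:R <= N by rewrite ler_peMr.
set B := mixed_cst n q; set T : R := 3 `^ N.
have B0 : 0 < B by exact: B_gt0.
have T0 : 0 < T by rewrite powR_gt0.
have [M PM] := P_growth q0 N_ge a0.
have step c : a <= c -> P q c / c `^ N <= P q (3 * c) / (3 * c) `^ N / 2 +
    B * (2 * B * T) `^ (q - 1) * (P q a / a `^ N).
  move=> ac; have c0 : 0 < c by exact: lt_le_trans ac.
  set l := (c / a) ^+ n.
  have l0 : 0 < l by rewrite exprn_gt0// divr_gt0.
  have BT0 : 0 < 2 * B * T by rewrite mulr_gt0// mulr_gt0.
  (* this weight makes B l d equal to 1 / (2 T) *)
  have d0 : 0 < (2 * B * T * l)^-1 by rewrite invr_gt0 mulr_gt0.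
  have := mixed_ge1 q1 a0 ac d0; rewrite mixed_cstE -/B -/l => h.
  rewrite ler_pdivrMr ?powR_gt0//; apply: le_trans h _.
  rewrite [leRHS]mulrDl [leLHS]mulrDr; apply: lerD.
    rewrite powRM ?(ltW c0)// -/T.
    apply: le_of_eq; field.
    by rewrite !gt_eqF ?powR_gt0.
  have -> : (2 * B * T * l)^-1 `^ (1 - q) = (2 * B * T) `^ (q - 1) * l `^ (q - 1).
    rewrite -powR_inv1 ?mulr_ge0 ?(ltW B0) ?(ltW T0) ?(ltW l0)// -powRrM mulN1r opprB.
    by rewrite powRM ?(ltW BT0) ?(ltW l0).
  have -> : c `^ N = l `^ q * a `^ N.
    rewrite /l -powR_mulrn ?divr_ge0 ?(ltW c0) ?(ltW a0)// -powRrM -/N.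
    by rewrite -powRM ?divr_ge0 ?(ltW c0) ?(ltW a0)// divfK// gt_eqF.
  rewrite -(mulr_powRB1 (ltW l0) q0).
  apply: le_of_eq; field.
  by rewrite !gt_eqF ?powR_gt0.
have := absorb_half a0 PM step ab.
rewrite ler_pdivrMr ?powR_gt0//; last exact: lt_le_trans ab.
move=> /le_trans; apply; apply: le_of_eq.
have b0 : 0 < b by exact: lt_le_trans ab.
have -> : (b / a) `^ N = b `^ N / a `^ N.
  rewrite powRM ?invr_ge0 ?(ltW a0) ?(ltW b0)//.
  by rewrite -powR_inv1 ?(ltW a0)// -powRrM mulN1r powRN.
rewrite /enlarge_ge1_cst -/N -/T -/B.
by field; rewrite gt_eqF// powR_gt0.
Qed.

(** As for [enlarge_ge1], with [c ^ n] instead of [c ^ (n q)]; the weight is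
    [3 ^ (- n) / 2]. *)
Let enlarge_le1 q a b : 0 < q <= 1 -> 0 < a -> a <= b ->
  P q b <= enlarge_le1_cst n q * (b / a) ^+ n * P q a.
Proof.
move=> q01 a0 ab; have /andP[q0 q1] := q01.
(* half of 3 ^ - n: the coefficient of the term to absorb *)
set d : R := (2 * 3 ^+ n)^-1.
have d0 : 0 < d by rewrite invr_gt0 mulr_gt0// exprn_gt0.
set D := d `^ (- ((1 - q) / q)) * ((2 * n%:R) ^+ n * tail_cst q).
have [M PM] := P_growth q0 (lexx n%:R) a0.
have step c : a <= c -> P q c / c `^ n%:R <=
    P q (3 * c) / (3 * c) `^ n%:R / 2 + D * (P q a / a ^+ n).
  move=> ac; have c0 : 0 < c by exact: lt_le_trans ac.
  rewrite !powR_mulrn ?mulr_ge0 ?(ltW c0)//.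
  rewrite ler_pdivrMr ?exprn_gt0//.
  apply: le_trans (mixed_le1 q01 a0 c0 d0) _.
  apply: (@le_trans _ _ (d * P q (3 * c) +
      d `^ (- ((1 - q) / q)) * (volume_cst n (c / a) * tail_cst q * P q a))).
    rewrite lerD2r ler_wpM2l ?(ltW d0)//; apply: P_le => //.
      by rewrite addr_gt0// mulr_gt0.
    by lra.
  rewrite [leRHS]mulrDl; apply: lerD; apply: le_of_eq.
    by rewrite /d exprMn; field; rewrite !gt_eqF ?exprn_gt0.
  rewrite /D /volume_cst [in LHS]exprMn expr_div_n; field.
  by rewrite gt_eqF// exprn_gt0.
have := absorb_half a0 PM step ab.
have b0 : 0 < b by exact: lt_le_trans ab.
rewrite powR_mulrn ?(ltW b0)// ler_pdivrMr ?exprn_gt0//.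
move=> /le_trans; apply; apply: le_of_eq.
rewrite /enlarge_le1_cst -/d -/D expr_div_n; field.
by rewrite gt_eqF// exprn_gt0.
Qed.

(** Nothing has to be absorbed: the wider aperture [b + 2 a <= 3 a] is compared with
    [a] by [enlarge_le1], and the weight [(b / a) ^ (n q)] gives both terms the same
    size. *)
Let shrink_le1 q a b : 0 < q <= 1 -> 0 < a -> 0 < b -> b <= a ->
  P q b <= shrink_le1_cst n q * (b / a) `^ (n%:R * q) * P q a.
Proof.
move=> q01 a0 b0 ba; have /andP[q0 q1] := q01.
set l := b / a; set N : R := n%:R * q.
have l0 : 0 < l by rewrite divr_gt0.
have d0 : 0 < l `^ N by rewrite powR_gt0.
apply: le_trans (mixed_le1 q01 a0 b0 d0) _.
have a30 : 0 < 3 * a by rewrite mulr_gt0.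
have P3 : P q (b + 2 * a) <= 3 ^+ n * enlarge_le1_cst n q * P q a.
  apply: (@le_trans _ _ (P q (3 * a))).
    by apply: P_le => //; [rewrite addr_gt0// mulr_gt0|lra].
  have := @enlarge_le1 q a (3 * a) q01 a0; rewrite mulfK ?gt_eqF//.
  by rewrite [3 ^+ n * _]mulrC; apply; lra.
have -> : (l `^ N) `^ (- ((1 - q) / q)) * (volume_cst n l * tail_cst q * P q a) =
    (2 * n%:R) ^+ n * tail_cst q * l `^ N * P q a.
  have -> : volume_cst n l = (2 * n%:R) ^+ n * l `^ n%:R.
    by rewrite /volume_cst exprMn powR_mulrn// ltW.
  rewrite -powRrM.
  have -> : l `^ N = l `^ (N * - ((1 - q) / q)) * l `^ n%:R.
    rewrite -powRD; last by apply/implyP => _; rewrite gt_eqF.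
    by congr (_ `^ _); rewrite /N; field; rewrite gt_eqF.
  by ring.
have -> : shrink_le1_cst n q * l `^ N * P q a =
    3 ^+ n * enlarge_le1_cst n q * P q a * l `^ N +
    (2 * n%:R) ^+ n * tail_cst q * l `^ N * P q a.
  by rewrite /shrink_le1_cst; ring.
by rewrite lerD2r mulrC ler_wpM2r// ltW.
Qed.

Lemma area_power_change q a b : 0 < q -> 0 < a -> 0 < b ->
  (area_power nu q b <= (aperture_cst n q *
     Num.max ((b / a) `^ n%:R) ((b / a) `^ (n%:R * q)))%:E * area_power nu q a)%E.
Proof.
move=> q0 a0 b0; rewrite !PE// -EFinM lee_fin.
set l := b / a; have l0 : 0 < l by rewrite divr_gt0.
have lnE : l ^+ n = l `^ n%:R by rewrite powR_mulrn// ltW.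
suff [c [c0 ch Pc]] : exists c, [/\ 0 <= c, c <= aperture_cst n q &
    P q b <= c * Num.max (l `^ n%:R) (l `^ (n%:R * q)) * P q a].
  apply: le_trans Pc _; rewrite ler_wpM2r// ler_wpM2r//.
  by rewrite le_max powR_ge0.
have c1 := shrink_ge1_cst_ge0 n q; have c2 := enlarge_ge1_cst_ge0 n q.
have c3 := enlarge_le1_cst_ge0 n q0; have c4 := shrink_le1_cst_ge0 n q0.
have mx1 : l `^ n%:R <= Num.max (l `^ n%:R) (l `^ (n%:R * q)).
  by rewrite le_max lexx.
have mx2 : l `^ (n%:R * q) <= Num.max (l `^ n%:R) (l `^ (n%:R * q)).
  by rewrite le_max lexx orbT.
have [q1|/ltW q1] := leP q 1; have [ba|/ltW ab] := leP b a.
- exists (shrink_le1_cst n q); split => //; first by rewrite /aperture_cst; lra.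
  apply: le_trans (shrink_le1 _ a0 b0 ba) _; first by rewrite q0.
  by rewrite ler_wpM2r// ler_wpM2l.
- exists (enlarge_le1_cst n q); split => //; first by rewrite /aperture_cst; lra.
  apply: le_trans (enlarge_le1 _ a0 ab) _; first by rewrite q0.
  by rewrite ler_wpM2r// ler_wpM2l// lnE.
- exists (shrink_ge1_cst n q); split => //; first by rewrite /aperture_cst; lra.
  apply: le_trans (shrink_ge1 q1 a0 b0 ba) _.
  by rewrite ler_wpM2r// ler_wpM2l// lnE.
- exists (enlarge_ge1_cst n q); split => //; first by rewrite /aperture_cst; lra.
  apply: le_trans (enlarge_ge1 q1 a0 ab) _.
  by rewrite ler_wpM2r// ler_wpM2l.
Qed.

End aperture_bounded_support.

(** * Change of aperture for arbitrary weights *)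

Lemma poweR_cvg_nondecreasing (R : realType) (q : R) (u : (\bar R)^nat) (l : \bar R) :
  0 < q -> (forall k, 0 <= u k)%E -> nondecreasing_seq u -> u @ \oo --> l ->
  (fun k => u k `^ q)%E @ \oo --> (l `^ q)%E.
Proof.
move=> q0 u0 ndu ul.
have lE : l = ereal_sup (range u).
  apply/esym/(@cvg_unique _ _ (u @ \oo)) => //.
  exact: ereal_nondecreasing_cvgn.
have ul' k : (u k <= l)%E by rewrite lE; apply: ereal_sup_ubound; exists k.
have l0 : (0 <= l)%E by exact: le_trans (ul' 0%N).
have nduq : nondecreasing_seq (fun k => u k `^ q)%E.
  by move=> i j ij; apply: poweR_le; [exact: ltW|exact: u0|exact: ndu].
have := ereal_nondecreasing_cvgn nduq.
congr (_ --> _); apply/eqP; rewrite eq_le; apply/andP; split.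
  apply: ge_ereal_sup => _ [k _ <-].
  by apply: poweR_le; [exact: ltW|exact: u0|exact: ul'].
set s := ereal_sup _.
have us k : (u k `^ q <= s)%E by apply: ereal_sup_ubound; exists k.
have s0 : (0 <= s)%E by apply: le_trans (us 0%N); exact: poweR_ge0.
have qK x : (0 <= x)%E -> ((x `^ q) `^ q^-1)%E = x.
  by move=> x0; rewrite -poweRrM mulfV ?gt_eqF// poweRe1.
have Kq x : (0 <= x)%E -> ((x `^ q^-1) `^ q)%E = x.
  by move=> x0; rewrite -poweRrM mulVf ?gt_eqF// poweRe1.
rewrite -[leRHS]Kq//; apply: poweR_le => //; first exact: ltW.
rewrite lE; apply: ge_ereal_sup => _ [k _ <-].
rewrite -[leLHS]qK//; apply: poweR_le => //; first by rewrite invr_ge0 ltW.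
exact: poweR_ge0.
Qed.

Section weighted_aperture.
Context {R : realType} {n : nat}.
Hypothesis n_gt0 : (0 < n)%N.
Variable w : spacetime R n -> R.
Hypotheses (mw : measurable_fun setT w) (w0 : forall z, 0 <= w z).
Local Notation leb := (lebesgue_tuple R n).
Local Notation mz := (lebesgue_spacetime R n).
Implicit Types (a b q : R) (x : euclid R n).

Definition weighted_cone a x : \bar R := (\int[mz]_(z in cone a x) (w z)%:E)%E.

Lemma weighted_cone_ge0 a x : (0 <= weighted_cone a x)%E.
Proof. by apply: integral_ge0 => z _; rewrite lee_fin. Qed.

Let box (k : nat) : set (spacetime R n) :=
  `[- k.+1%:R, k.+1%:R]%classic `*` eball (@origin R n) k.+1%:R.

Let measurable_box k : measurable (box k).
Proof. by apply: measurableX; [exact: measurable_itv|exact: measurable_eball]. Qed.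

Let box_finite k : (mz (box k) < +oo)%E.
Proof.
rewrite /lebesgue_spacetime product_measure1E; last 2 first.
- exact: measurable_itv.
- exact: measurable_eball.
have foo : (lebesgue_measure (`[(- k.+1%:R)%R, k.+1%:R%R]%classic : set R) < +oo)%E.
  by rewrite lebesgue_measure_itv /=; case: ifP => _; rewrite ?ltry// -EFinB ltry.
apply: lte_mul_pinfty => //; first by rewrite ge0_fin_numE.
by apply: le_lt_trans (ltry _); apply: eball_volume_le.
Qed.

Let trunc (k : nat) (z : spacetime R n) : R := Num.min (w z) k%:R * \1_(box k) z.

Let trunc_ge0 k z : 0 <= trunc k z.
Proof. by rewrite mulr_ge0// le_min w0 ler0n. Qed.

Let measurable_trunc k : measurable_fun setT (EFin \o trunc k).
Proof.
apply/measurable_EFinP; apply: measurable_funM; last exact: measurable_indic.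
exact: measurable_minr.
Qed.

Let trunc_finite k : (\int[mz]_z (EFin \o trunc k) z < +oo)%E.
Proof.
apply: (@le_lt_trans _ _ (\int[mz]_(z in box k) (k%:R)%:E)%E); last first.
  rewrite integral_cst//; apply: lte_mul_pinfty => //; exact: box_finite.
rewrite [leRHS]integral_mkcond; apply: ge0_le_integral_sub.
- by move=> z _; rewrite lee_fin.
- by move=> z _; apply: erestrict_ge0 => ? _; rewrite lee_fin.
move=> z _; split => //; rewrite /= /trunc patchE indicE; case: ifPn => zb.
  by rewrite mulr1 lee_fin ge_min lexx orbT.
by rewrite mulr0.
Qed.

Let nu k : {finite_measure set (spacetime R n) -> \bar R} :=
  density_finite_measure (measurable_trunc k)
    (fun z => trunc_ge0 k z : (0 <= (EFin \o trunc k) z)%E) (trunc_finite k).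

Let nuE k A : nu k A = (\int[mz]_(z in A) (trunc k z)%:E)%E.
Proof. by []. Qed.

Let trunc_nd i j z : (i <= j)%N -> trunc i z <= trunc j z.
Proof.
move=> ij; apply: ler_pM => //; first by rewrite le_min w0 ler0n.
  rewrite le_min !ge_min lexx/=; apply/orP; right; by rewrite ler_nat.
rewrite !indicE; case: (boolP (z \in box i)) => [|_]; last by case: (_ \in _).
rewrite inE => -[/= z1 z2]; rewrite mem_set//; split => /=.
  move: z1; rewrite !in_itv/= => /andP[z1 z1']; apply/andP; split.
    by apply: le_trans z1; rewrite lerN2 ler_nat.
  by apply: (le_trans z1'); rewrite ler_nat.
by apply: lt_le_trans z2 _; rewrite ler_nat.
Qed.

Let trunc_cvg z : (fun k => (trunc k z)%:E) @ \oo --> (w z)%:E.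
Proof.
apply: cvg_near_cst.
have [k1 wk1] : exists k : nat, w z <= k%:R.
  by exists (Num.bound (w z)); apply/ltW/archi_boundP.
have [k2 wk2] : exists k : nat, `|z.1 : R| <= k%:R.
  by exists (Num.bound `|z.1 : R|); apply/ltW/archi_boundP.
have [k3 wk3] : exists k : nat, eudist (@origin R n) z.2 <= k%:R.
  exists (Num.bound (eudist (@origin R n) z.2)); apply/ltW/archi_boundP.
  exact: eudist_ge0.
(* beyond this rank the truncation leaves the value at z unchanged *)
exists (k1 + k2 + k3)%N => // k /= kk.
rewrite /trunc (min_idPl _); last first.
  apply: (le_trans wk1); rewrite ler_nat; apply: leq_trans kk.
  by rewrite -addnA leq_addr.
rewrite indicE mem_set ?mulr1//; split => /=.
  rewrite in_itv/= -ler_norml; apply: (le_trans wk2); rewrite ler_nat.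
  by apply/leqW/(leq_trans _ kk); rewrite addnAC leq_addl.
rewrite eballE/=; apply: (le_lt_trans wk3); rewrite ltr_nat ltnS.
by apply: leq_trans kk; rewrite leq_addl.
Qed.

Let cone_mass_nd a x : nondecreasing_seq (fun k => cone_mass (nu k) a x).
Proof.
move=> i j ij; apply: ge0_le_integral_sub => [z _|z _|z az].
- by rewrite lee_fin.
- by rewrite lee_fin.
- by split => //; rewrite lee_fin trunc_nd.
Qed.

Let cone_mass_cvg a x :
  (fun k => cone_mass (nu k) a x) @ \oo --> weighted_cone a x.
Proof.
rewrite /weighted_cone.
under [in X in _ --> X]eq_integral.
  move=> z _; rewrite -(cvg_lim _ (@trunc_cvg z))//.
  over.
apply: cvg_monotone_convergence.
- exact: measurable_cone.
- by move=> k; apply: measurable_funTS; exact: measurable_trunc.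
- by move=> k z _; rewrite lee_fin.
- by move=> z _ i j ij; rewrite lee_fin trunc_nd.
Qed.

Let cone_mass_le_weighted k a x : (cone_mass (nu k) a x <= weighted_cone a x)%E.
Proof.
apply: ge0_le_integral_sub => [z _|z _|z az].
- by rewrite lee_fin.
- by rewrite lee_fin.
- split=> //; rewrite lee_fin /trunc indicE; case: (_ \in _).
    by rewrite mulr1 ge_min lexx.
  by rewrite mulr0.
Qed.

(** The truncations of [w] at level [k] and to a bounded box define finite measures
    of bounded support, whose cone masses increase to the weighted ones. *)
Lemma weighted_power_change q a b : 0 < q -> 0 < a -> 0 < b ->
  (\int[leb]_x (weighted_cone b x) `^ q <= (aperture_cst n q *
     Num.max ((b / a) `^ n%:R) ((b / a) `^ (n%:R * q)))%:E *
     \int[leb]_x (weighted_cone a x) `^ q)%E.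
Proof.
move=> q0 a0 b0; set C := _ * Num.max _ _.
have C0 : 0 <= C.
  by rewrite mulr_ge0 ?(ltW (aperture_cst_gt0 _ _))// le_max powR_ge0.
have step k : (area_power (nu k) q b <=
    C%:E * \int[leb]_x (weighted_cone a x) `^ q)%E.
  apply: (@le_trans _ _ (C%:E * area_power (nu k) q a)%E).
    apply: (@area_power_change _ _ (nu k) (@origin R n) k.+1%:R) => // A Az.
    rewrite nuE; apply: integral0_eq => z /Az zA.
    rewrite /trunc indicE memNset ?mulr0// => -[/=].
    by rewrite in_itv/= => /andP[_ /zA].
  apply: lee_wpmul2l; first by rewrite lee_fin.
  apply: ge0_le_integral_sub => [x _|x _|x _]; [exact: poweR_ge0..|].
  split=> //; apply: poweR_le; first exact: ltW.
    exact: cone_mass_ge0.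
  exact: cone_mass_le_weighted.
have lim : (fun k => area_power (nu k) q b) @ \oo -->
    (\int[leb]_x (weighted_cone b x) `^ q)%E.
  under [in X in _ --> X]eq_integral.
    move=> x _.
    rewrite -(cvg_lim _ (poweR_cvg_nondecreasing q0
      (fun k => cone_mass_ge0 (nu k) b x) (@cone_mass_nd b x) (@cone_mass_cvg b x)))//.
    over.
  apply: cvg_monotone_convergence => //.
  - by move=> k; exact: measurable_cone_mass_power.
  - by move=> k x _; exact: poweR_ge0.
  - move=> x _ i j ij; apply: poweR_le; first exact: ltW.
      exact: cone_mass_ge0.
    exact: cone_mass_nd.
rewrite -(cvg_lim _ lim)//; apply: lime_le; first by apply/cvg_ex; eexists; exact: lim.
exact: nearW.
Qed.

End weighted_aperture.

(** * Tent norms for finite exponents *)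

Section tent_norm_change.
Context {R : realType} {n : nat}.
Hypothesis n_gt0 : (0 < n)%N.
Implicit Types (g h : spacetime R n -> R[i]) (a b q C : R) (x : euclid R n).
Local Notation leb := (lebesgue_tuple R n).
Local Notation mz := (lebesgue_spacetime R n).

Lemma sqnorm_ge0 (u : R[i]) : 0 <= sqnorm u.
Proof. by rewrite addr_ge0 ?sqr_ge0. Qed.

(** The density, with respect to Lebesgue measure on the half-space, of the measure
    whose cone masses are the squares of the area function. *)
Definition tent_weight g : spacetime R n -> R :=
  (fun z => sqnorm (g z) / (z.1 : R) ^+ n / (z.1 : R)) \_ upper_half.

Lemma tent_weight_ge0 g z : 0 <= tent_weight g z.
Proof.
rewrite /tent_weight patchE; case: ifPn => //; rewrite inE /upper_half /= => z0.
by rewrite !divr_ge0 ?sqnorm_ge0 ?exprn_ge0// ltW.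
Qed.

Lemma measurable_upper_half : measurable (@upper_half R n).
Proof.
have := @measurable_fst _ _ (measurableTypeR R) (euclid R n) measurableT
  _ (measurable_itv `]0, +oo[).
by rewrite setTI; congr measurable; apply/seteqP; split => z /=;
  rewrite in_itv/= andbT.
Qed.

Lemma measurable_tent_weight g :
  measurable_fun upper_half (fun z => complex.Re (g z)) ->
  measurable_fun upper_half (fun z => complex.Im (g z)) ->
  measurable_fun setT (tent_weight g).
Proof.
move=> mRe mIm.
have := measurable_restrictT
  (fun z : spacetime R n => sqnorm (g z) / (z.1 : R) ^+ n / (z.1 : R))
  measurable_upper_half.
move=> h; apply: h.1.
have mt : measurable_fun upper_half (fun z : spacetime R n => (z.1 : R)).
  by apply: measurable_funTS; exact: measurable_fst.
have mV (f : spacetime R n -> R) : measurable_fun upper_half f ->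
    (forall z, upper_half z -> 0 <= f z) ->
    measurable_fun upper_half (fun z => (f z)^-1).
  move=> mf f0; apply: (eq_measurable_fun (fun z => f z `^ (-1))).
    by move=> z; rewrite inE => /f0 fz; rewrite powR_inv1.
  exact: (measurableT_comp (measurable_powR (-1)) mf).
apply: measurable_funM; last by apply: mV => // z /ltW.
apply: measurable_funM; last first.
  by apply: mV => [|z /ltW z0]; [exact: measurable_funX|rewrite exprn_ge0].
by apply: measurable_funD; exact: measurable_funX.
Qed.

Lemma areaE g h a x : 0 < a ->
  {ae mz, forall z, upper_half z -> g z = h z} ->
  area a g x = (weighted_cone (tent_weight h) a x `^ 2^-1)%E.
Proof.
move=> a0 gh; rewrite /area; congr (_ `^ _)%E.
have ge0 k z : upper_half z -> (0 <= (\1_(eball x (a * (z.1 : R))) z.2 / (z.1 : R) ^+ n *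
    sqnorm (k z) / (z.1 : R))%:E)%E.
  rewrite /upper_half /= => z0.
  rewrite lee_fin divr_ge0 ?(ltW z0)// mulr_ge0 ?sqnorm_ge0//.
  by rewrite divr_ge0// exprn_ge0// ltW.
transitivity (\int[mz]_(z in upper_half) (\1_(eball x (a * (z.1 : R))) z.2 /
    (z.1 : R) ^+ n * sqnorm (h z) / (z.1 : R))%:E)%E.
  apply: ae_eq_integral_lower; [exact: ge0|exact: ge0|].
  by move: gh; apply: filterS => z + z0 => ->.
rewrite /weighted_cone integral_mkcond [RHS]integral_mkcond.
apply: eq_integral => z _; rewrite !patchE /tent_weight patchE indicE.
have E : (z \in cone a x) = (z.2 \in eball x (a * (z.1 : R))) by [].
rewrite E.
have [zu|/negP zu] := boolP (z \in upper_half).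
  case: (z.2 \in _); last by rewrite mulr0n !mul0r.
  by congr EFin; rewrite mulr1n mul1r; congr (_ / _); exact: mulrC.
case: ifPn => //.
Qed.

Lemma tent_normE g h a q : 0 < q -> 0 < a ->
  {ae mz, forall z, upper_half z -> g z = h z} ->
  tent_norm q%:E a g =
  ((\int[leb]_x (weighted_cone (tent_weight h) a x) `^ (q / 2)) `^ q^-1)%E.
Proof.
move=> q0 a0 gh; rewrite /tent_norm unlock; congr (_ `^ _)%E.
apply: eq_integral => x _; rewrite (areaE x a0 gh) gee0_abs ?poweR_ge0//.
by rewrite -poweRrM mulrC.
Qed.

Lemma h_up_root q a b : 0 < q -> 0 < a -> 0 < b ->
  Num.max ((b / a) `^ n%:R) ((b / a) `^ (n%:R * (q / 2))) `^ q^-1 =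
  h_up n q%:E (a / b).
Proof.
move=> q0 a0 b0; rewrite /h_up /dim_over.
have ba0 : 0 < b / a by rewrite divr_gt0.
have ab r : (a / b) `^ (- r) = (b / a) `^ r.
  have -> : a / b = (b / a) `^ (- 1) by rewrite powR_inv1 ?(ltW ba0)// invf_div.
  by rewrite -powRrM mulN1r opprK.
rewrite !ab maxC.
have maxE (u v : R) : 0 <= u -> 0 <= v ->
    Num.max u v `^ q^-1 = Num.max (u `^ q^-1) (v `^ q^-1).
  move=> u0 v0; have q'0 : 0 <= q^-1 by rewrite invr_ge0 ltW.
  have mono (s t : R) : 0 <= s -> s <= t -> s `^ q^-1 <= t `^ q^-1.
    by move=> s0 st; apply: ge0_ler_powR; rewrite ?nnegrE//; exact: le_trans st.
  have [uv|/ltW vu] := leP u v.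
    by rewrite max_r// mono.
  by rewrite max_l// mono.
rewrite maxE ?powR_ge0// -!powRrM; congr (Num.max (_ `^ _) (_ `^ _)).
by field; rewrite gt_eqF.
Qed.

Lemma tent_norm_change_finite q : 0 < q -> exists2 C, 0 < C &
  forall a b, 0 < a -> 0 < b -> forall g, ae_measurable g ->
  (tent_norm q%:E b g <= (C * h_up n q%:E (a / b))%:E * tent_norm q%:E a g)%E.
Proof.
move=> q0; have q20 : 0 < q / 2 by rewrite divr_gt0.
exists (aperture_cst n (q / 2) `^ q^-1).
  by rewrite powR_gt0// aperture_cst_gt0.
move=> a b a0 b0 g [h [mRe mIm gh]].
rewrite !(tent_normE q0 _ gh)//.
have := weighted_power_change n_gt0 (measurable_tent_weight mRe mIm)
  (tent_weight_ge0 h) q20 a0 b0.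
set X := integral _ _ _; set Y := integral _ _ _ => XY.
have X0 : (0 <= X)%E by apply: integral_ge0 => x _; exact: poweR_ge0.
have Y0 : (0 <= Y)%E by apply: integral_ge0 => x _; exact: poweR_ge0.
have q'0 : 0 <= q^-1 by rewrite invr_ge0 ltW.
apply: le_trans (poweR_le q'0 X0 XY) _.
have c0 := ltW (aperture_cst_gt0 n q20).
rewrite poweRM//; last first.
  by rewrite lee_fin mulr_ge0// le_max powR_ge0.
by rewrite poweR_EFin powRM ?h_up_root// le_max powR_ge0.
Qed.

Lemma eball_volumeE x r : exists2 v, 0 <= v & leb (eball x r) = v%:E.
Proof.
have : leb (eball x r) \is a fin_num.
  have [r0|r0] := leP 0 r.
    by rewrite ge0_fin_numE//; apply: le_lt_trans (eball_volume_le x r0) (ltry _).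
  rewrite (_ : eball x r = set0) ?measure0//; apply/seteqP; split=> y //.
  by move=> /eball_gt0 /(lt_trans r0); rewrite ltxx.
by move=> /fineK <-; exists (fine (leb (eball x r))) => //; exact: fine_ge0.
Qed.

Lemma subset_tent_aperture a b x r : 0 < a -> a <= b -> tent b x r `<=` tent a x r.
Proof.
move=> a0 ab z [/andP[z0 zr] xz]; have b0 : 0 < b by exact: lt_le_trans ab.
split; first (apply/andP; split => //).
  move: zr; rewrite !ltr_pdivlMr//; apply: le_lt_trans.
  by rewrite ler_wpM2l// ltW.
by apply: lt_le_trans xz _; rewrite lerD2l lerN2 ler_wpM2r// ltW.
Qed.

(** The tent of the narrower aperture [b] is taller by the factor [a / b]; a ball
    of radius [r + (a / b) r <= 2 (a / b) r] is large enough to cover it. *)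
Lemma subset_tent_radius a b x r : 0 < b -> b <= a ->
  tent b x r `<=` tent a x (2 * (a / b) * r).
Proof.
move=> b0 ba z [/andP[z0 zr] xz]; have a0 : 0 < a by exact: lt_le_trans ba.
move: zr; rewrite ltr_pdivlMr// => zr.
have r0 : 0 < r by apply: lt_trans zr; rewrite mulr_gt0.
have ab1 : 1 <= a / b by rewrite ler_pdivlMr ?mul1r.
have az : a * z.1 < a / b * r.
  rewrite mulrAC ltr_pdivlMr// -mulrA ltr_pM2l//.
have rab : r <= a / b * r by rewrite ler_peMl// ltW.
have bz := mulr_gt0 b0 z0.
have u0 : 0 < a / b * r by rewrite mulr_gt0// divr_gt0.
have -> : 2 * (a / b) * r = 2 * (a / b * r) by ring.
split; first (apply/andP; split => //).
  by rewrite ltr_pdivlMr//; lra.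
by apply: lt_le_trans xz _; lra.
Qed.

End tent_norm_change.

(** * Tent norms for the infinite exponent *)

Section carleson_change.
Context {R : realType} {n : nat}.
Hypothesis n_gt0 : (0 < n)%N.
Implicit Types (g h : spacetime R n -> R[i]) (a b q C : R) (x : euclid R n).
Local Notation leb := (lebesgue_tuple R n).
Local Notation mz := (lebesgue_spacetime R n).

Lemma le_tent_integral a b x r s g : tent b x r `<=` tent a x s ->
  (\int[mz]_(z in tent b x r) (sqnorm (g z) / (z.1 : R))%:E <=
   \int[mz]_(z in tent a x s) (sqnorm (g z) / (z.1 : R))%:E)%E.
Proof.
have ge0 c t z : tent c x t z -> (0 <= (sqnorm (g z) / (z.1 : R))%:E)%E.
  by move=> [/andP[z0 _] _]; rewrite lee_fin divr_ge0 ?sqnorm_ge0// ltW.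
move=> ba; apply: ge0_le_integral_sub => [z|z|z bz]; [exact: ge0..|].
by split => //; exact: ba.
Qed.

Lemma mul_div_EFin C v a : 0 < a ->
  ((C%:E * (v%:E / (a ^+ n)%:E)) = (C * (v / a ^+ n))%:E)%E.
Proof. by move=> a0; rewrite inver gt_eqF ?exprn_gt0// -!EFinM. Qed.

Lemma h_up_infty_ge a b : 0 < a -> 0 < b ->
  1 <= h_up n (+oo : \bar R)%E (a / b) /\
  (b / a) ^+ n <= h_up n (+oo : \bar R)%E (a / b) ^+ 2.
Proof.
move=> a0 b0; have ab0 : 0 < a / b by rewrite divr_gt0.
rewrite /h_up /dim_over oppr0 powRr0; split; first by rewrite le_max lexx orbT.
apply: (@le_trans _ _ (((a / b) `^ (- (n%:R / 2))) ^+ 2)).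
  rewrite -[leRHS]powR_mulrn ?powR_ge0// -powRrM.
  have -> : - (n%:R / 2) * 2%:R = (-1) * n%:R :> R by field.
  by rewrite powRrM powR_inv1 ?(ltW ab0)// invf_div powR_mulrn// divr_ge0// ltW.
by rewrite lerXn2r ?nnegrE ?le_max ?powR_ge0 ?lexx.
Qed.

(** For [a <= b] the tent shrinks while the normalisation [|B| / a ^ n] becomes
    [(b / a) ^ n] times smaller; for [b <= a] the tent is contained in one above a
    ball [2 a / b] times larger, and the two powers of [a / b] cancel. *)
Lemma carleson_bound_change a b g C : 0 < a -> 0 < b -> carleson_bound a g C ->
  carleson_bound b g ((4 * n%:R) ^+ n * h_up n (+oo : \bar R)%E (a / b) * C).
Proof.
move=> a0 b0 [C0 gC].
have [h1 h2] := h_up_infty_ge a0 b0; set H := h_up _ _ _ in h1 h2 *.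
set c : R := (4 * n%:R) ^+ n.
have n1 : 1 <= n%:R :> R by rewrite ler1n.
have c1 : 1 <= c by rewrite exprn_ege1//; lra.
have H0 : 0 <= H by apply: le_trans h1.
have c0 : 0 <= c by apply: le_trans c1.
split; first by rewrite !mulr_ge0.
move=> x r r0; have [v v0 vE] := eball_volumeE x r.
have bn0 : 0 < b ^+ n by rewrite exprn_gt0.
have an0 : 0 < a ^+ n by rewrite exprn_gt0.
have cc : c <= c ^+ 2 by rewrite expr2 ler_peMl.
have HH : 1 <= H ^+ 2 by rewrite exprn_ege1.
rewrite vE mul_div_EFin//.
have C20 : 0 <= C ^+ 2 by rewrite sqr_ge0.
have goal_of (k : R) : 0 <= k -> k <= c ^+ 2 * H ^+ 2 ->
    C ^+ 2 * k * (v / b ^+ n) <= (c * H * C) ^+ 2 * (v / b ^+ n).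
  move=> k0 kc; rewrite ler_wpM2r ?divr_ge0 ?(ltW bn0)//.
  by rewrite !exprMn mulrC ler_wpM2r.
have [ab|/ltW ba] := leP a b.
  apply: le_trans (le_tent_integral g (subset_tent_aperture a0 ab)) _.
  apply: le_trans (gC x r r0) _; rewrite vE mul_div_EFin// lee_fin.
  have -> : C ^+ 2 * (v / a ^+ n) = C ^+ 2 * (b / a) ^+ n * (v / b ^+ n).
    by rewrite expr_div_n; field; rewrite !gt_eqF.
  apply: goal_of; first by rewrite exprn_ge0// divr_ge0// ltW.
  apply: (le_trans h2); rewrite ler_peMl ?exprn_ge0//.
  exact: le_trans cc.
apply: le_trans (le_tent_integral g (subset_tent_radius b0 ba)) _.
have s0 : 0 < 2 * (a / b) * r by rewrite mulr_gt0// mulr_gt0// divr_gt0.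
apply: le_trans (gC x _ s0) _.
have [u u0 uE] := eball_volumeE x (2 * (a / b) * r).
rewrite uE mul_div_EFin// lee_fin.
have ule : u <= (2 * (2 * (a / b) * r)) ^+ n.
  by rewrite -lee_fin -uE; apply: eball_volume_le; exact: ltW.
have vge : (r / n%:R) ^+ n <= v by rewrite -lee_fin -vE; exact: eball_volume_ge.
apply: (@le_trans _ _ (C ^+ 2 * c * (v / b ^+ n))); last first.
  apply: goal_of => //; apply: (le_trans cc); rewrite ler_peMr// exprn_ge0//.
rewrite -mulrA ler_wpM2l// ler_pdivrMr//.
apply: (le_trans ule).
have -> : (2 * (2 * (a / b) * r)) ^+ n = c * (a ^+ n / b ^+ n) * (r / n%:R) ^+ n.
  rewrite /c -expr_div_n -!exprMn; congr (_ ^+ _).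
  by field; rewrite !gt_eqF//; lra.
apply: (@le_trans _ _ (c * (a ^+ n / b ^+ n) * v)).
  by rewrite ler_wpM2l// mulr_ge0// divr_ge0// ltW.
by apply: le_of_eq; ring.
Qed.

Lemma tent_norm_change_infty : exists2 C, 0 < C &
  forall a b, 0 < a -> 0 < b -> forall g,
  (tent_norm (+oo : \bar R)%E b g <=
   (C * h_up n (+oo : \bar R)%E (a / b))%:E * tent_norm (+oo : \bar R)%E a g)%E.
Proof.
have C0 : 0 < (4 * n%:R) ^+ n :> R by rewrite exprn_gt0// mulr_gt0// ltr0n.
exists ((4 * n%:R) ^+ n) => // a b a0 b0 g.
have [h1 _] := h_up_infty_ge a0 b0.
set k := _ * h_up _ _ _.
have k0 : 0 < k by rewrite mulr_gt0//; exact: lt_le_trans h1.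
rewrite /tent_norm -lee_pdivrMl//.
apply: le_ereal_inf_tmp => _ [C Ca <-].
rewrite lee_pdivrMl// -EFinM; apply: ereal_inf_lbound.
by exists (k * C) => //; exact: carleson_bound_change.
Qed.

Lemma tent_norm_change (p : \bar R) : (0 < p)%E -> exists2 C, 0 < C &
  forall a b, 0 < a -> 0 < b -> forall g, ae_measurable g ->
  (tent_norm p b g <= (C * h_up n p (a / b))%:E * tent_norm p a g)%E.
Proof.
case: p => [q| |]// p0; first exact: tent_norm_change_finite.
have [C C0 hC] := tent_norm_change_infty.
by exists C => // a b a0 b0 g _; exact: hC.
Qed.

Lemma tent_norm_ge0 (p : \bar R) a g : (0 <= tent_norm p a g)%E.
Proof.
case: p => [q| |]//=; first exact: Lnorm_ge0.
by apply: le_ereal_inf_tmp => _ [C [C0 _] <-]; rewrite lee_fin.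
Qed.

(** Turns the upper bound for the exchanged apertures into the lower bound. *)
Lemma h_up_swap (p : \bar R) a b : 0 < a -> 0 < b ->
  h_up n p (b / a) * h_low n p (a / b) = 1.
Proof.
move=> a0 b0; rewrite /h_up /h_low.
have ba0 : 0 < b / a by rewrite divr_gt0.
have E r : (a / b) `^ r = (b / a) `^ (- r).
  have -> : a / b = (b / a) `^ (- 1) by rewrite powR_inv1 ?(ltW ba0)// invf_div.
  by rewrite -powRrM mulN1r.
rewrite !E; set e := - _; set f := - dim_over _ _.
have ge0 r : (b / a) `^ r * (b / a) `^ (- r) = 1.
  by rewrite powRN divff// gt_eqF// powR_gt0.
have mono r s : (b / a) `^ r <= (b / a) `^ s -> (b / a) `^ (- s) <= (b / a) `^ (- r).
  by move=> rs; rewrite !powRN lef_pV2 ?posrE ?powR_gt0.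
have [h|/ltW h] := leP ((b / a) `^ e) ((b / a) `^ f).
  by rewrite (min_idPr (mono _ _ h)) ge0.
by rewrite (min_idPl (mono _ _ h)) ge0.
Qed.

End carleson_change.

(** * Indicators of slabs *)

Section slab_example.
Context {R : realType} {n : nat}.
Hypothesis n_gt0 : (0 < n)%N.
Implicit Types (a b q C rho : R) (x : euclid R n).
Local Notation leb := (lebesgue_tuple R n).
Local Notation mz := (lebesgue_spacetime R n).

Definition slab (B : set (euclid R n)) : set (spacetime R n) :=
  (`[1, 2]%classic : set (measurableTypeR R)) `*` B.

Lemma measurable_slab B : measurable B -> measurable (slab B).
Proof. by move=> mB; apply: measurableX => //; exact: (measurable_itv `[1, 2]). Qed.

Lemma slab_volume B : measurable B -> mz (slab B) = leb B.
Proof.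
move=> mB; have m12 : measurable (`[1, 2]%classic : set (measurableTypeR R)).
  exact: (measurable_itv `[1, 2]).
rewrite /lebesgue_spacetime product_measure1E//.
have l12 : lebesgue_measure (`[1, 2]%classic : set R) = 1%:E :> \bar R.
  by rewrite lebesgue_measure_itv /= lte_fin ltr1n -EFinB; congr EFin; ring.
rewrite -[RHS]mul1e; congr (_ * _)%E; exact: l12.
Qed.

Lemma slab_height B z : slab B z -> 1 <= (z.1 : R) <= 2.
Proof. by move=> [/=]; rewrite in_itv. Qed.

Local Notation o := (@origin R n).

Definition slab_fun rho (z : spacetime R n) : R[i] :=
  Complex (\1_(slab (eball o rho)) z) 0.

Lemma sqnorm_slab_fun rho z : sqnorm (slab_fun rho z) = \1_(slab (eball o rho)) z.
Proof.
rewrite /sqnorm /slab_fun /= expr0n addr0 indicE.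
by case: (_ \in _); rewrite ?expr1n ?expr0n.
Qed.

Lemma ae_measurable_slab_fun rho : ae_measurable (slab_fun rho).
Proof.
exists (slab_fun rho); split.
- apply: measurable_funTS; apply: measurable_indic.
  by apply: measurable_slab; exact: measurable_eball.
- exact: measurable_cst.
- exact: aeW.
Qed.

Lemma locally_square_integrable_slab_fun rho : 0 < rho ->
  locally_square_integrable (slab_fun rho).
Proof.
move=> rho0; split; first exact: ae_measurable_slab_fun.
move=> K _ _.
have ms : measurable (slab (eball o rho)).
  by apply: measurable_slab; exact: measurable_eball.
apply: (@le_lt_trans _ _ (\int[mz]_z (\1_(slab (eball o rho)) z)%:E)%E).
  apply: ge0_le_integral_sub => [z _|z _|z _].
  - by rewrite lee_fin sqnorm_ge0.
  - by rewrite lee_fin.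
  - by split => //; rewrite sqnorm_slab_fun.
apply: (@le_lt_trans _ _ (mz (slab (eball o rho)))).
  by rewrite integral_indic// setIT.
rewrite slab_volume; last exact: measurable_eball.
by apply: le_lt_trans (eball_volume_le _ (ltW rho0)) _; rewrite ltry.
Qed.

(** The weight is at most [1] on the slab, whose intersection with the cone projects
    into [B(x, 2 a)] and into [B(0, rho)]. *)
Lemma weighted_cone_slab_le a rho x : 0 < a -> 0 < rho ->
  (weighted_cone (tent_weight (slab_fun rho)) a x <=
   (4 ^+ n * Num.min a rho ^+ n)%:E)%E.
Proof.
move=> a0 rho0.
pose B := eball x (2 * a) `&` eball o rho.
have mB : measurable B by apply: measurableI; exact: measurable_eball.
have m0 : 0 < Num.min a rho by rewrite lt_min a0.
apply: (@le_trans _ _ (mz (slab B))).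
  rewrite -[leRHS]mul1e -integral_cst; last exact: measurable_slab.
  rewrite /weighted_cone [leLHS]integral_mkcond [leRHS]integral_mkcond.
  have one0 z : (0 <= (cst 1 \_ (slab B)) z :> \bar R)%E.
    by apply: erestrict_ge0 => ? _; rewrite lee_fin.
  apply: ge0_le_integral_sub => [z _|z _|z _].
  - by apply: erestrict_ge0 => ? _; rewrite lee_fin tent_weight_ge0.
  - exact: one0.
  split => //; rewrite patchE; case: ifPn => [|_]; last exact: one0.
  rewrite inE => xz; rewrite /tent_weight patchE; case: ifPn => [_|_]; last first.
    exact: one0.
  rewrite sqnorm_slab_fun indicE.
  have [|_] := boolP (z \in _); last by rewrite !mul0r; exact: one0.
  rewrite inE => zs; rewrite mul1r.
  have /andP[z1 z2] := slab_height zs.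
  have z0 : 0 < (z.1 : R) by exact: lt_le_trans z1.
  rewrite patchE mem_set.
    rewrite lee_fin -invfM invf_le1 ?mulr_gt0 ?exprn_gt0//.
    by rewrite -exprSr exprn_ege1.
  split; first exact: zs.1.
  split; last exact: zs.2.
  by apply: lt_le_trans xz _; rewrite mulrC ler_wpM2r// ltW.
rewrite slab_volume//.
apply: (@le_trans _ _ ((2 * (2 * Num.min a rho)) ^+ n)%:E); last first.
  by rewrite lee_fin -exprMn mulrA; apply: le_of_eq; congr (_ ^+ _); ring.
have [ar|/ltW ra] := leP a rho.
  apply: le_trans (eball_volume_le x _); last by rewrite mulr_ge0// ltW.
  by apply: le_measure; rewrite ?inE//; [exact: measurable_eball|move=> y []].
apply: (@le_trans _ _ (leb (eball o rho))).
  by apply: le_measure; rewrite ?inE//; [exact: measurable_eball|move=> y []].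
apply: le_trans (eball_volume_le o (ltW rho0)) _.
rewrite lee_fin lerXn2r ?nnegrE ?mulr_ge0 ?(ltW rho0)//; lra.
Qed.

Lemma weighted_cone_slab_eq0 a rho x : 0 < a -> 0 < rho ->
  ~ eball o (3 * Num.max a rho) x ->
  weighted_cone (tent_weight (slab_fun rho)) a x = 0%E.
Proof.
move=> a0 rho0 ox; apply: integral0_eq => z xz.
rewrite /tent_weight patchE; case: ifPn => // _.
rewrite sqnorm_slab_fun indicE; have [|_] := boolP (z \in _); last by rewrite !mul0r.
rewrite inE => zs; exfalso; apply: ox.
have /andP[z1 z2] := slab_height zs.
rewrite eballE /=; apply: le_lt_trans (eudist_triangle o z.2 x) _.
have h1 : eudist o z.2 < rho by exact: zs.2.
have h2 : eudist z.2 x < a * z.1 by rewrite eudistC; exact: xz.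
have h3 : a * z.1 <= 2 * a by rewrite mulrC ler_wpM2r// ltW.
have h4 : a <= Num.max a rho by rewrite le_max lexx.
have h5 : rho <= Num.max a rho by rewrite le_max lexx orbT.
by set M := Num.max a rho in h4 h5 *; lra.
Qed.

(** The least value [2 ^ - (n + 1)] of the weight on the slab times the lower
    bound for the volume of a ball of radius [1 / 2]. *)
Definition slab_low_cst : R := (2 ^+ n.+1)^-1 * ((2 * n%:R) ^+ n)^-1.

Lemma slab_low_cst_gt0 : 0 < slab_low_cst.
Proof.
by rewrite mulr_gt0 ?invr_gt0 ?exprn_gt0// mulr_gt0// ltr0n.
Qed.

(** Above [B(x, a)] the cone contains the whole slab, so it is enough to find a ball
    of radius [min(a, rho) / 2] in the intersection of [B(x, a)] and [B(0, rho)]: it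
    is centered at [x] if [a <= rho] and at [0] otherwise. *)
Lemma weighted_cone_slab_ge a rho x : 0 < a -> 0 < rho ->
  eball o (Num.max a rho / 2) x ->
  ((slab_low_cst * Num.min a rho ^+ n)%:E <=
    weighted_cone (tent_weight (slab_fun rho)) a x)%E.
Proof.
move=> a0 rho0 ox.
have m0 : 0 < Num.min a rho by rewrite lt_min a0.
have [c [cx co]] : exists c : euclid R n,
    eball c (Num.min a rho / 2) `<=` eball x a /\
    eball c (Num.min a rho / 2) `<=` eball o rho.
  have [ar|/ltW ra] := leP a rho.
    exists x; rewrite (max_r ar) in ox; split => y yx.
      by apply: lt_le_trans yx _; lra.
    rewrite !eballE /= in ox yx *.
    apply: le_lt_trans (eudist_triangle o x y) _; lra.
  exists o; rewrite (max_l ra) in ox; split => y oy.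
    rewrite !eballE /= in ox oy *.
    apply: le_lt_trans (eudist_triangle x o y) _; rewrite eudistC; lra.
  by apply: lt_le_trans oy _; lra.
pose B := eball c (Num.min a rho / 2).
have mB : measurable B by exact: measurable_eball.
apply: (@le_trans _ _ (((2 ^+ n.+1)^-1)%:E * mz (slab B))%E).
  rewrite slab_volume// /slab_low_cst -mulrA EFinM; apply: lee_wpmul2l.
    by rewrite lee_fin invr_ge0 exprn_ge0.
  apply: le_trans (eball_volume_ge c _); last by rewrite divr_gt0.
  rewrite lee_fin -exprVn -exprMn; apply: le_of_eq; congr (_ ^+ _).
  by rewrite invfM; ring.
rewrite -integral_cst; last exact: measurable_slab.
apply: ge0_le_integral_sub => [z _|z _|z zB].
- by rewrite lee_fin invr_ge0 exprn_ge0.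
- by rewrite lee_fin tent_weight_ge0.
have /andP[z1 z2] := slab_height zB.
have z0 : 0 < (z.1 : R) by exact: lt_le_trans z1.
split.
  by apply: lt_le_trans (cx _ zB.2) _; rewrite ler_peMr// ltW.
rewrite lee_fin /tent_weight patchE mem_set; last by [].
rewrite sqnorm_slab_fun indicE mem_set; last by split; [exact: zB.1|exact: co zB.2].
rewrite mul1r -invfM -exprSr lef_pV2 ?posrE ?exprn_gt0//.
by rewrite lerXn2r ?nnegrE// ltW.
Qed.

End slab_example.

Arguments slab_low_cst : clear implicits.

(** * Tent norms of slabs *)

Section slab_norm.
Context {R : realType} {n : nat}.
Hypothesis n_gt0 : (0 < n)%N.
Implicit Types (a b q C rho : R) (x : euclid R n).
Local Notation leb := (lebesgue_tuple R n).
Local Notation mz := (lebesgue_spacetime R n).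
Local Notation o := (@origin R n).
Local Notation norm p a rho := (tent_norm p a (@slab_fun R n rho)).

Definition slab_profile (p : \bar R) a rho : R :=
  Num.min a rho `^ (n%:R / 2) * Num.max a rho `^ dim_over n p.

Let N_gt0 : 0 < n%:R :> R. Proof. by rewrite ltr0n. Qed.

Let min_gt0 a rho : 0 < a -> 0 < rho -> 0 < Num.min a rho.
Proof. by move=> a0 rho0; rewrite lt_min a0. Qed.

Let max_gt0 a rho : 0 < a -> 0 < rho -> 0 < Num.max a rho.
Proof. by move=> a0 rho0; rewrite lt_max a0. Qed.

Lemma sqr_powR_half (y e : R) : (y `^ (e / 2)) ^+ 2 = y `^ e.
Proof. by rewrite -powR_mulrn ?powR_ge0// -powRrM divfK// pnatr_eq0. Qed.

(** The norm of a function whose cone mass is [k m ^ n] on a set of volume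
    [(u M) ^ n]. *)
Lemma power_profile q (k u m M : R) :
  0 < q -> 0 < k -> 0 < u -> 0 < m -> 0 < M ->
  ((k * m ^+ n) `^ (q / 2) * (u * M) ^+ n) `^ q^-1 =
  k `^ 2^-1 * u `^ (n%:R / q) * (m `^ (n%:R / 2) * M `^ (n%:R / q)).
Proof.
move=> q0 k0 u0 m0 M0.
have mn : m ^+ n = m `^ n%:R by rewrite powR_mulrn// ltW.
have uM : (u * M) ^+ n = u `^ n%:R * M `^ n%:R.
  by rewrite exprMn !powR_mulrn// ltW.
rewrite mn uM !powRM ?mulr_ge0 ?powR_ge0 ?(ltW k0)// -!powRrM.
have -> : q / 2 * q^-1 = 2^-1 by field; rewrite gt_eqF.
by ring.
Qed.

Let trivial_ae rho : {ae mz, forall z, upper_half z -> slab_fun rho z = slab_fun rho z}.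
Proof. exact: aeW. Qed.

Lemma slab_norm_finite_le q a rho : 0 < q -> 0 < a -> 0 < rho ->
  (norm q%:E a rho <=
    ((4 ^+ n) `^ 2^-1 * 6 `^ (n%:R / q) * slab_profile q%:E a rho)%:E)%E.
Proof.
move=> q0 a0 rho0; rewrite (tent_normE q0 a0 (@trivial_ae rho)).
have m0 := min_gt0 a0 rho0; have M0 := max_gt0 a0 rho0.
rewrite -power_profile ?exprn_gt0// -poweR_EFin.
apply: poweR_le; first by rewrite invr_ge0 ltW.
  by apply: integral_ge0 => x _; exact: poweR_ge0.
set k := 4 ^+ n * _; have k0 : 0 < k by rewrite mulr_gt0 ?exprn_gt0.
have q20 : 0 < q / 2 by rewrite divr_gt0.
apply: (@le_trans _ _
    (\int[leb]_(x in eball o (3 * Num.max a rho)) (k `^ (q / 2))%:E)%E).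
  rewrite [leRHS]integral_mkcond; apply: ge0_le_integral_sub => [x _|x _|x _].
  - exact: poweR_ge0.
  - by apply: erestrict_ge0 => ? _; rewrite lee_fin powR_ge0.
  split=> //; rewrite patchE; case: ifPn => [_|].
    rewrite -poweR_EFin; apply: poweR_le; rewrite ?weighted_cone_ge0 ?(ltW q20)//.
      by move=> z; exact: tent_weight_ge0.
    exact: weighted_cone_slab_le.
  rewrite notin_setE => ox.
  by rewrite weighted_cone_slab_eq0// poweR0r// gt_eqF.
rewrite integral_cst; last exact: measurable_eball.
rewrite EFinM; apply: lee_wpmul2l; first by rewrite lee_fin powR_ge0.
apply: le_trans (eball_volume_le _ _) _; first by rewrite mulr_ge0// ltW.
by rewrite lee_fin; apply: le_of_eq; congr (_ ^+ _); ring.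
Qed.

Lemma slab_norm_finite_ge q a rho : 0 < q -> 0 < a -> 0 < rho ->
  ((slab_low_cst R n `^ 2^-1 * (2 * n%:R)^-1 `^ (n%:R / q) *
    slab_profile q%:E a rho)%:E <= norm q%:E a rho)%E.
Proof.
move=> q0 a0 rho0; rewrite (tent_normE q0 a0 (@trivial_ae rho)).
have m0 := min_gt0 a0 rho0; have M0 := max_gt0 a0 rho0.
have s0 := @slab_low_cst_gt0 R n n_gt0.
have n20 : 0 < (2 * n%:R)^-1 :> R by rewrite invr_gt0 mulr_gt0.
rewrite -power_profile// -poweR_EFin.
apply: poweR_le; first by rewrite invr_ge0 ltW.
  by rewrite lee_fin mulr_ge0 ?powR_ge0// exprn_ge0// mulr_ge0 ?(ltW n20) ?(ltW M0).
set k := slab_low_cst R n * _; have k0 : 0 < k by rewrite mulr_gt0 ?exprn_gt0.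
have q20 : 0 < q / 2 by rewrite divr_gt0.
apply: (@le_trans _ _
    (\int[leb]_(x in eball o (Num.max a rho / 2)) (k `^ (q / 2))%:E)%E).
  rewrite integral_cst; last exact: measurable_eball.
  rewrite EFinM; apply: lee_wpmul2l; first by rewrite lee_fin powR_ge0.
  apply: le_trans (eball_volume_ge _ _); last by rewrite divr_gt0.
  by rewrite lee_fin; apply: le_of_eq; congr (_ ^+ _); rewrite invfM; ring.
apply: ge0_le_integral_sub => [x _|x _|x ox].
- by rewrite lee_fin powR_ge0.
- exact: poweR_ge0.
split=> //; rewrite -poweR_EFin; apply: poweR_le; first exact: ltW.
  by rewrite lee_fin ltW.
exact: weighted_cone_slab_ge.
Qed.

(** A tent of radius at most [a] does not reach height [1]. A larger one meets the
    slab above [B(x, r)] and [B(0, rho)], where [r = a (r / a)] and [1 <= r / a]. *)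
Lemma slab_tent_integral_le a rho x r : 0 < a -> 0 < rho -> 0 < r ->
  (\int[mz]_(z in tent a x r) (sqnorm (slab_fun rho z) / (z.1 : R))%:E <=
   ((2 * (Num.min a rho * (r / a))) ^+ n)%:E)%E.
Proof.
move=> a0 rho0 r0; have m0 := min_gt0 a0 rho0.
have weight_le z : (0 <= (sqnorm (slab_fun rho z) / (z.1 : R))%:E <=
    (\1_(slab (eball o rho)) z)%:E)%E.
  rewrite sqnorm_slab_fun indicE; have [|_] := boolP (z \in _); last first.
    by rewrite mul0r lexx.
  rewrite inE => /slab_height/andP[z1 _]; have z0 := lt_le_trans ltr01 z1.
  by rewrite !lee_fin mul1r invr_ge0 ltW//= invf_le1.
have [ra|ar] := leP r a.
  have ra0 : 0 < r / a by rewrite divr_gt0.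
  rewrite integral0_eq; first by rewrite lee_fin exprn_ge0// ltW// mulr_gt0// mulr_gt0.
  move=> z [/andP[z0 zr] _]; rewrite sqnorm_slab_fun indicE.
  rewrite memNset ?mul0r// => /slab_height/andP[z1 _].
  have za : a <= z.1 * a by rewrite ler_peMl// ltW.
  by move: zr; rewrite ltr_pdivlMr//; lra.
pose B := eball x r `&` eball o rho.
have mB : measurable B by apply: measurableI; exact: measurable_eball.
apply: (@le_trans _ _ (mz (slab B))).
  rewrite -[leRHS]mul1e -integral_cst; last exact: measurable_slab.
  rewrite [leLHS]integral_mkcond [leRHS]integral_mkcond.
  have one0 z : (0 <= (cst 1 \_ (slab B)) z :> \bar R)%E.
    by apply: erestrict_ge0 => ? _; rewrite lee_fin.
  apply: ge0_le_integral_sub => [z _|z _|z _].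
  - by apply: erestrict_ge0 => y _; have /andP[] := weight_le y.
  - exact: one0.
  split => //; rewrite patchE; case: ifPn => [|_]; last exact: one0.
  rewrite inE => xz; have /andP[_ /le_trans] := weight_le z; apply.
  rewrite indicE; have [|_] := boolP (z \in _); last exact: one0.
  rewrite inE => zs; rewrite patchE mem_set//; split; first exact: zs.1.
  split; last exact: zs.2.
  have [/andP[z0 _] zx] := xz.
  by apply: lt_le_trans zx _; rewrite gerBl mulr_ge0// ltW.
rewrite slab_volume//.
have rE : r = a * (r / a) by rewrite mulrCA divff ?mulr1// gt_eqF.
have ra1 : 1 <= r / a by rewrite ler_pdivlMr// mul1r ltW.
have [_|_] := leP a rho.
  rewrite -rE; apply: le_trans (eball_volume_le x (ltW r0)).
  by apply: le_measure; rewrite ?inE//; [exact: measurable_eball|move=> y []].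
apply: (@le_trans _ _ (leb (eball o rho))).
  by apply: le_measure; rewrite ?inE//; [exact: measurable_eball|move=> y []].
apply: le_trans (eball_volume_le o (ltW rho0)) _.
have ra0 : 0 <= r / a by exact: le_trans ra1.
rewrite lee_fin lerXn2r//.
- by rewrite nnegrE mulr_ge0// ltW.
- by rewrite nnegrE mulr_ge0// mulr_ge0// ltW.
- by rewrite ler_wpM2l// ler_peMr// ltW.
Qed.

Lemma slab_norm_infty_le a rho : 0 < a -> 0 < rho ->
  (norm (+oo : \bar R)%E a rho <=
    ((2 * n%:R) `^ (n%:R / 2) * slab_profile +oo%E a rho)%:E)%E.
Proof.
move=> a0 rho0; have m0 := min_gt0 a0 rho0.
apply: ereal_inf_lbound.
exists ((2 * n%:R) `^ (n%:R / 2) * slab_profile +oo%E a rho) => //.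
rewrite /slab_profile /dim_over powRr0 mulr1.
split; first by rewrite mulr_ge0 ?powR_ge0.
move=> x r r0; apply: le_trans (slab_tent_integral_le x a0 rho0 r0) _.
have [v v0 vE] := eball_volumeE x r.
have vge : (r / n%:R) ^+ n <= v by rewrite -lee_fin -vE; exact: eball_volume_ge.
rewrite vE mul_div_EFin// lee_fin.
have sq (c : R) : 0 < c -> (c `^ (n%:R / 2)) ^+ 2 = c ^+ n.
  move=> c0; rewrite -powR_mulrn ?powR_ge0// -powRrM.
  by rewrite divfK ?powR_mulrn ?(ltW c0)// pnatr_eq0.
rewrite [in leRHS]exprMn !sq ?mulr_gt0//.
have an0 : 0 < a ^+ n by rewrite exprn_gt0.
apply: (@le_trans _ _ ((2 * n%:R) ^+ n * Num.min a rho ^+ n *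
    ((r / n%:R) ^+ n / a ^+ n))); last first.
  rewrite ler_wpM2l ?mulr_ge0 ?exprn_ge0 ?mulr_ge0 ?(ltW m0)//.
  by rewrite ler_wpM2r// invr_ge0 ltW.
rewrite -expr_div_n -!exprMn; apply: le_of_eq; congr (_ ^+ _).
by field; rewrite !gt_eqF.
Qed.

Definition slab_infty_low_cst : R := (2 * (8 * n%:R) ^+ n)^-1.

Lemma slab_infty_low_cst_gt0 : 0 < slab_infty_low_cst.
Proof. by rewrite invr_gt0 mulr_gt0// exprn_gt0// mulr_gt0. Qed.

(** Tested on the ball of radius [4 a] centered at the origin, whose tent contains
    the part of the slab above [B(0, 2 a)]. *)
Lemma slab_norm_infty_ge a rho : 0 < a -> 0 < rho ->
  ((slab_infty_low_cst `^ 2^-1 * slab_profile +oo%E a rho)%:E <=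
    norm (+oo : \bar R)%E a rho)%E.
Proof.
move=> a0 rho0; have m0 := min_gt0 a0 rho0.
rewrite -[X in _ `^ X]mul1r.
apply: le_ereal_inf_tmp => _ [C [C0 hC] <-]; rewrite lee_fin.
rewrite /slab_profile /dim_over powRr0 mulr1.
set m := Num.min a rho in m0 *.
have a40 : 0 < 4 * a by rewrite mulr_gt0.
have := hC o _ a40; have [v v0 vE] := eball_volumeE o (4 * a).
have vle : v <= (2 * (4 * a)) ^+ n.
  by rewrite -lee_fin -vE; apply: eball_volume_le; exact: ltW.
rewrite vE mul_div_EFin// => h.
have low : ((2^-1 * (m / n%:R) ^+ n)%:E <=
    \int[mz]_(z in tent a o (4 * a)) (sqnorm (slab_fun rho z) / (z.1 : R))%:E)%E.
  have mB : measurable (eball o m) by exact: measurable_eball.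
  apply: (@le_trans _ _ ((2^-1)%:E * mz (slab (eball o m)))%E).
    rewrite slab_volume// EFinM; apply: lee_wpmul2l; first by rewrite lee_fin.
    exact: eball_volume_ge.
  rewrite -integral_cst; last exact: measurable_slab.
  apply: ge0_le_integral_sub => [z _|z [/andP[z0 _] _]|z zs].
  - by rewrite lee_fin.
  - by rewrite lee_fin divr_ge0 ?sqnorm_ge0// ltW.
  have /andP[z1 z2] := slab_height zs; have z0 := lt_le_trans ltr01 z1.
  have z2a : z.1 * a <= 2 * a by rewrite ler_wpM2r// ltW.
  have om : eudist o z.2 < m by exact: zs.2.
  have ma : m <= a by rewrite /m ge_min lexx.
  have mrho : m <= rho by rewrite /m ge_min lexx orbT.
  split.
    split; first by rewrite z0/= ltr_pdivlMr//; lra.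
    by rewrite eballE /=; lra.
  rewrite lee_fin sqnorm_slab_fun indicE mem_set; last first.
    by split; [exact: zs.1|exact: lt_le_trans om mrho].
  by rewrite mul1r lef_pV2// posrE.
have {}h : 2^-1 * (m / n%:R) ^+ n <= C ^+ 2 * 8 ^+ n.
  rewrite -lee_fin; apply: (le_trans low); apply: (le_trans h); rewrite lee_fin.
  rewrite ler_wpM2l ?sqr_ge0// ler_pdivrMr ?exprn_gt0//.
  apply: (le_trans vle); rewrite -exprMn; apply: le_of_eq; congr (_ ^+ _); ring.
have E8 : 0 < 8 ^+ n :> R by rewrite exprn_gt0.
have En : 0 < n%:R ^+ n :> R by rewrite exprn_gt0.
have {}h : slab_infty_low_cst * m ^+ n <= C ^+ 2.
  rewrite -(ler_pM2r E8); apply: le_trans h; apply: le_of_eq.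
  have aux (e f k : R) : 0 < e -> 0 < f ->
      (2 * (e * f))^-1 * k * e = 2^-1 * (k / f).
    by move=> e0 f0; field; rewrite !gt_eqF.
  by rewrite /slab_infty_low_cst exprMn expr_div_n aux.
have c0 := slab_infty_low_cst_gt0.
rewrite -(@ler_pXn2r _ 2)// ?nnegrE ?mulr_ge0 ?powR_ge0// exprMn.
rewrite sqr_powR_half powRr1 ?(ltW c0)//.
by rewrite sqr_powR_half powR_mulrn ?(ltW m0).
Qed.

Lemma slab_norm_bounds (p : \bar R) : (0 < p)%E ->
  exists A B : R, [/\ 0 < A, 0 < B & forall a rho, 0 < a -> 0 < rho ->
    ((A * slab_profile p a rho)%:E <= norm p a rho)%E /\
    (norm p a rho <= (B * slab_profile p a rho)%:E)%E].
Proof.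
have n20 : 0 < 2 * n%:R :> R by rewrite mulr_gt0.
case: p => [q||]// q0.
  exists (slab_low_cst R n `^ 2^-1 * (2 * n%:R)^-1 `^ (n%:R / q)).
  exists ((4 ^+ n) `^ 2^-1 * 6 `^ (n%:R / q)); split.
  - by rewrite mulr_gt0// powR_gt0 ?invr_gt0// slab_low_cst_gt0.
  - by rewrite mulr_gt0// powR_gt0// exprn_gt0.
  move=> a rho a0 rho0.
  by split; [exact: slab_norm_finite_ge|exact: slab_norm_finite_le].
exists (slab_infty_low_cst `^ 2^-1), ((2 * n%:R) `^ (n%:R / 2)); split.
- by rewrite powR_gt0// slab_infty_low_cst_gt0.
- by rewrite powR_gt0.
move=> a rho a0 rho0.
by split; [exact: slab_norm_infty_ge|exact: slab_norm_infty_le].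
Qed.

End slab_norm.

Arguments slab_profile {R} n p a rho.

(** * The growth is attained *)

Section growth_attained.
Context {R : realType} {n : nat}.
Hypothesis n_gt0 : (0 < n)%N.
Implicit Types (a b e rho : R) (p : \bar R).

(** With [rho = max(a, b)] the dependence on the aperture is [a ^ (n / 2)]; with
    [rho = min(a, b)] it is [a ^ (n / p)]. *)
Lemma slab_profile_power p a b e : 0 < a -> 0 < b ->
  e = n%:R / 2 \/ e = dim_over n p ->
  exists rho k, [/\ 0 < rho, 0 < k,
    slab_profile n p a rho = k * a `^ e & slab_profile n p b rho = k * b `^ e].
Proof.
move=> a0 b0 [->|->]; rewrite /slab_profile.
  exists (Num.max a b), (Num.max a b `^ dim_over n p).
  have M0 : 0 < Num.max a b by rewrite lt_max a0.
  have aM : a <= Num.max a b by rewrite le_max lexx.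
  have bM : b <= Num.max a b by rewrite le_max lexx orbT.
  by split; rewrite ?powR_gt0// ?(min_l aM) ?(max_r aM) ?(min_l bM) ?(max_r bM) mulrC.
exists (Num.min a b), (Num.min a b `^ (n%:R / 2)).
have m0 : 0 < Num.min a b by rewrite lt_min a0.
have ma : Num.min a b <= a by rewrite ge_min lexx.
have mb : Num.min a b <= b by rewrite ge_min lexx orbT.
by split; rewrite ?powR_gt0// ?(min_r ma) ?(max_l ma) ?(min_r mb) ?(max_l mb).
Qed.

Lemma slab_ratio p : (0 < p)%E -> exists c c' : R, [/\ 0 < c, 0 < c' &
  forall a b, 0 < a -> 0 < b ->
  forall e, e = n%:R / 2 \/ e = dim_over n p ->
  exists g : spacetime R n -> R[i], [/\ locally_square_integrable g,
    (0 < tent_norm p a g < +oo)%E,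
    (tent_norm p b g <= (c * (a / b) `^ (- e))%:E * tent_norm p a g)%E &
    ((c' * (a / b) `^ (- e))%:E * tent_norm p a g <= tent_norm p b g)%E]].
Proof.
move=> p0; have [A [B [A0 B0 AB]]] := slab_norm_bounds n_gt0 p0.
exists (B / A), (A / B); split; rewrite ?divr_gt0// => a b a0 b0 e eE.
have [rho [k [rho0 k0 ka kb]]] := slab_profile_power a0 b0 eE.
exists (slab_fun rho).
have [lea ale] := AB a rho a0 rho0; have [leb ble] := AB b rho b0 rho0.
rewrite ka in lea ale; rewrite kb in leb ble.
have ae0 : 0 < a `^ e by rewrite powR_gt0.
have be0 : 0 < b `^ e by rewrite powR_gt0.
have -> : (a / b) `^ (- e) = b `^ e / a `^ e.
  rewrite powRN powRM ?invr_ge0 ?(ltW a0) ?(ltW b0)//.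
  by rewrite -(powR_inv1 (ltW b0)) -powRrM mulN1r powRN invfM invrK mulrC.
have N0 := tent_norm_ge0 p a (@slab_fun R n rho).
split; first exact: locally_square_integrable_slab_fun.
- apply/andP; split.
    by apply: lt_le_trans lea; rewrite lte_fin !mulr_gt0.
  by apply: le_lt_trans ale (ltry _).
- apply: (le_trans ble); apply: (@le_trans _ _
    ((B / A * (b `^ e / a `^ e))%:E * (A * (k * a `^ e))%:E)%E).
    rewrite -EFinM lee_fin; apply: le_of_eq; field.
    by rewrite !gt_eqF.
  apply: lee_wpmul2l => //.
  by rewrite lee_fin mulr_ge0// divr_ge0// ltW.
- apply: le_trans leb; apply: (@le_trans _ _
    ((A / B * (b `^ e / a `^ e))%:E * (B * (k * a `^ e))%:E)%E); last first.
    rewrite -EFinM lee_fin; apply: le_of_eq; field.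
    by rewrite !gt_eqF.
  apply: lee_wpmul2l => //.
  by rewrite lee_fin mulr_ge0// divr_ge0// ltW.
Qed.

End growth_attained.

Theorem theorem0p1 (R : realType) (n : nat) (p : \bar R)
    (n_ge1 : (1 <= n)%N) (p_gt0 : (0 < p)%E) :
  (exists C C' : R, [/\ 0 < C, 0 < C' &
    forall alpha beta : R, 0 < alpha -> 0 < beta ->
    forall g : spacetime R n -> R[i], locally_square_integrable g ->
      ((C * h_low n p (alpha / beta))%:E * tent_norm p alpha g
         <= tent_norm p beta g)%E /\
      (tent_norm p beta g
         <= (C' * h_up n p (alpha / beta))%:E * tent_norm p alpha g)%E]) /\
  (exists c c' : R, [/\ 0 < c, 0 < c' &
    forall alpha beta : R, 0 < alpha -> 0 < beta ->
    exists g1 g2 : spacetime R n -> R[i],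
      [/\ locally_square_integrable g1 /\ locally_square_integrable g2,
          (0 < tent_norm p alpha g1 < +oo)%E,
          (0 < tent_norm p alpha g2 < +oo)%E,
          (tent_norm p beta g1
             <= (c * h_low n p (alpha / beta))%:E * tent_norm p alpha g1)%E &
          (tent_norm p beta g2
             >= (c' * h_up n p (alpha / beta))%:E * tent_norm p alpha g2)%E]]).
Proof.
split.
  have [C C0 change] := tent_norm_change n_ge1 p_gt0.
  exists C^-1, C; split; rewrite ?invr_gt0// => a b a0 b0 g [mg _].
  split; last exact: change.
  have low0 : 0 < h_low n p (a / b) by rewrite lt_min !powR_gt0// divr_gt0.
  (* the upper bound with the two apertures exchanged *)
  have := lee_wpmul2l _ (change b a b0 a0 g mg).
  move=> /(_ (C^-1 * h_low n p (a / b))%:E).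
  rewrite lee_fin mulr_ge0 ?invr_ge0 ?(ltW C0) ?(ltW low0)// => /(_ isT).
  rewrite muleA -EFinM.
  have -> : C^-1 * h_low n p (a / b) * (C * h_up n p (b / a)) =
      (C^-1 * C) * (h_up n p (b / a) * h_low n p (a / b)) by ring.
  by rewrite h_up_swap// mulVf ?gt_eqF// mul1r mul1e.
have [c [c' [c0 c'0 ratio]]] := slab_ratio n_ge1 p_gt0.
exists c, c'; split=> // a b a0 b0.
have either (e1 e2 : R) : e1 = n%:R / 2 \/ e1 = dim_over n p ->
    e2 = n%:R / 2 \/ e2 = dim_over n p ->
    h_low n p (a / b) = (a / b) `^ (- e1) -> h_up n p (a / b) = (a / b) `^ (- e2) ->
    exists g1 g2 : spacetime R n -> R[i],
      [/\ locally_square_integrable g1 /\ locally_square_integrable g2,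
          (0 < tent_norm p a g1 < +oo)%E, (0 < tent_norm p a g2 < +oo)%E,
          (tent_norm p b g1 <= (c * h_low n p (a / b))%:E * tent_norm p a g1)%E &
          (tent_norm p b g2 >= (c' * h_up n p (a / b))%:E * tent_norm p a g2)%E].
  move=> E1 E2 -> ->.
  have [g1 [l1 N1 u1 _]] := ratio a b a0 b0 e1 E1.
  have [g2 [l2 N2 _ v2]] := ratio a b a0 b0 e2 E2.
  by exists g1, g2.
have [h|/ltW h] :=
    leP ((a / b) `^ (- (n%:R / 2))) ((a / b) `^ (- dim_over n p)).
- apply: (either (n%:R / 2) (dim_over n p)); [by left|by right|..].
  + by rewrite /h_low (min_l h).
  + by rewrite /h_up (max_r h).
- apply: (either (dim_over n p) (n%:R / 2)); [by right|by left|..].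
  + by rewrite /h_low (min_r h).
  + by rewrite /h_up (max_l h).
Qed.
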